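(* Let $\Sigma$ be a set. Then $T(\Sigma)$, the set of isomorphism types of non-trivial pruned $\Sigma$-trees equipped with pruned multiplication and the unary operations $+$ and $*$, is a free object in the quasivariety of adequate semigroups (viewed as $(2,1,1)$-algebras), freely generated by the set $\Sigma$ of base trees: for every adequate semigroup $S$ and function $\chi:\Sigma\to S$ there is a unique $(2,1,1)$-morphism $T(\Sigma)\to S$ extending $\chi$.
   Context: Adequate semigroups: for a semigroup $S$ let $S^1=S$ if $S$ is a monoid and otherwise $S$ with an identity adjoined. Define $a\,\mathcal{L}^*\,b$ iff for all $x,y\in S^1$: $ax=ay\Leftrightarrow bx=by$; and $a\,\mathcal{R}^*\,b$ iff for all $x,y\in S^1$: $xa=ya\Leftrightarrow xb=yb$. $S$ is adequate if its idempotents commute and every $\mathcal{L}^*$-class and every $\mathcal{R}^*$-class contains an idempotent (necessarily unique); $x^+$ denotes the idempotent $\mathcal{R}^*$-related to $x$ and $x^*$ the idempotent $\mathcal{L}^*$-related to $x$. Adequate semigroups are $(2,1,1)$-algebras (multiplication, $+$, $*$) and morphisms preserve all three operations. Trees: A $\Sigma$-tree is a finite directed graph whose underlying undirected graph is a tree, edges labelled by elements of $\Sigma$, with distinguished start and end vertices such that there is a (possibly empty) directed path from the start vertex to the end vertex. A tree with one vertex is trivial; a base tree has exactly one edge, with start vertex its initial vertex and end vertex its terminal vertex; the base tree labelled $a$ is identified with $a\in\Sigma$. A morphism $X\to Y$ maps vertices to vertices and edges to edges, preserving initial vertex, terminal vertex and label of edges, and maps start/end vertex of $X$ to start/end vertex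 of $Y$; isomorphisms are morphisms bijective on vertices and edges. A retraction is an idempotent morphism $X\to X$, its image being a retract; $X$ is pruned if it has no non-identity retraction. Every tree $X$ has a pruned retract, unique up to isomorphism, whose isomorphism type is denoted $\overline{X}$. Unpruned operations: $X\times Y$ glues the end vertex of (a copy of) $X$ to the start vertex of (a disjoint copy of) $Y$, with start vertex that of $X$ and end vertex that of $Y$; $X^{(+)}$ is $X$ with end vertex moved to the start vertex; $X^{( * )}$ is $X$ with start vertex moved to the end vertex. Pruned operations: $XY=\overline{X\times Y}$, $X^+=\overline{X^{(+)}}$, $X^*=\overline{X^{( * )}}$. *)

(* Defs.v *)
From mathcomp Require Import all_boot.
Set Implicit Arguments. Unset Strict Implicit. Unset Printing Implicit Defensive.

(* S^1 is modelled as option S, None being the (adjoined) identity.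
   (Adjoining an identity even when S is a monoid does not change L*/R*.) *)
Definition ract (S : Type) (mul : S -> S -> S) (a : S) (x : option S) : S :=
  match x with Some x => mul a x | None => a end.
Definition lact (S : Type) (mul : S -> S -> S) (x : option S) (a : S) : S :=
  match x with Some x => mul x a | None => a end.

Definition Lstar (S : Type) (mul : S -> S -> S) (a b : S) : Prop :=
  forall x y : option S, ract mul a x = ract mul a y <-> ract mul b x = ract mul b y.
Definition Rstar (S : Type) (mul : S -> S -> S) (a b : S) : Prop :=
  forall x y : option S, lact mul x a = lact mul y a <-> lact mul x b = lact mul y b.

Definition idem (S : Type) (mul : S -> S -> S) (e : S) : Prop := mul e e = e.

(* (S, mul, plus, star) is an adequate semigroup with x^+ = plus x, x^* = star x:
   idempotents commute, plus x is an idempotent R*-related to x and star x an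
   idempotent L*-related to x (such idempotents are unique). *)
Definition adequate (S : Type) (mul : S -> S -> S) (plus star : S -> S) : Prop :=
  (forall a b c, mul a (mul b c) = mul (mul a b) c) /\
  (forall e f, idem mul e -> idem mul f -> mul e f = mul f e) /\
  (forall a, idem mul (plus a) /\ Rstar mul a (plus a)) /\
  (forall a, idem mul (star a) /\ Lstar mul a (star a)).

Definition morph211 (A B : Type) (mA : A -> A -> A) (pA sA : A -> A)
  (mB : B -> B -> B) (pB sB : B -> B) (h : A -> B) : Prop :=
  (forall x y, h (mA x y) = mB (h x) (h y)) /\
  (forall x, h (pA x) = pB (h x)) /\
  (forall x, h (sA x) = sB (h x)).

Record tree (Sig : Type) := Tree {
  tV : finType; tE : finType;
  tsrc : tE -> tV; ttgt : tE -> tV; tlab : tE -> Sig;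
  tst : tV; ten : tV }.

Fixpoint uwalk (Sig : Type) (X : tree Sig) (u : tV X) (w : seq (tE X * bool))
  (v : tV X) : Prop :=
  match w with
  | [::] => u = v
  | s :: w' => (if s.2 then tsrc s.1 else ttgt s.1) = u /\
               uwalk (if s.2 then ttgt s.1 else tsrc s.1) w' v
  end.

Definition connected (Sig : Type) (X : tree Sig) : Prop :=
  forall u v : tV X, exists w, uwalk u w v.
Definition acyclic (Sig : Type) (X : tree Sig) : Prop :=
  forall (u : tV X) w, uwalk u w u -> uniq (map fst w) -> w = [::].
Definition is_tree (Sig : Type) (X : tree Sig) : Prop :=
  connected X /\ acyclic X /\
  exists w, all (fun s => s.2) w /\ uwalk (tst X) w (ten X).

Definition nontrivial (Sig : Type) (X : tree Sig) : Prop := #|tV X| <> 1.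

Definition base_tree (Sig : Type) (a : Sig) : tree Sig :=
  @Tree Sig bool unit (fun _ => false) (fun _ => true) (fun _ => a) false true.

Definition is_morph (Sig : Type) (X Y : tree Sig) (fv : tV X -> tV Y)
  (fe : tE X -> tE Y) : Prop :=
  (forall e, tsrc (fe e) = fv (tsrc e)) /\
  (forall e, ttgt (fe e) = fv (ttgt e)) /\
  (forall e, tlab (fe e) = tlab e) /\
  fv (tst X) = tst Y /\ fv (ten X) = ten Y.

Definition iso (Sig : Type) (X Y : tree Sig) : Prop :=
  exists fv fe, @is_morph Sig X Y fv fe /\ bijective fv /\ bijective fe.

Definition retraction (Sig : Type) (X : tree Sig) (fv : tV X -> tV X)
  (fe : tE X -> tE X) : Prop :=
  is_morph fv fe /\ (forall v, fv (fv v) = fv v) /\ (forall e, fe (fe e) = fe e).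

Definition pruned (Sig : Type) (X : tree Sig) : Prop :=
  forall fv fe, @retraction Sig X fv fe -> (forall v, fv v = v) /\ (forall e, fe e = e).

(* W is isomorphic to a retract of X: there is a retraction r of X and a
   morphism i : W -> X, injective on vertices and edges, whose image is
   exactly the image of r (so i is an isomorphism of W onto the retract). *)
Definition is_retract_of (Sig : Type) (W X : tree Sig) : Prop :=
  exists rv re iv ie,
    @retraction Sig X rv re /\ @is_morph Sig W X iv ie /\
    injective iv /\ injective ie /\
    (forall v, (exists w, iv w = v) <-> (exists u, rv u = v)) /\
    (forall e, (exists w, ie w = e) <-> (exists d, re d = e)).

Definition pruned_retract (Sig : Type) (W X : tree Sig) : Prop :=
  is_retract_of W X /\ pruned W.

Definition glueV (Sig : Type) (X Y : tree Sig) :=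
  (tV X + {v : tV Y | v != tst Y})%type.

Definition glue_map (Sig : Type) (X Y : tree Sig) (v : tV Y) : glueV X Y :=
  match (insub v : option {v : tV Y | v != tst Y}) with
  | Some u => inr u
  | None => inl (ten X)
  end.

Definition tprod (Sig : Type) (X Y : tree Sig) : tree Sig :=
  @Tree Sig (glueV X Y) (tE X + tE Y)%type
    (fun e => match e with inl e => inl (tsrc e) | inr e => glue_map X (tsrc e) end)
    (fun e => match e with inl e => inl (ttgt e) | inr e => glue_map X (ttgt e) end)
    (fun e => match e with inl e => tlab e | inr e => tlab e end)
    (inl (tst X)) (glue_map X (ten Y)).

Definition tplus0 (Sig : Type) (X : tree Sig) : tree Sig :=
  @Tree Sig (tV X) (tE X) (@tsrc Sig X) (@ttgt Sig X) (@tlab Sig X) (tst X) (tst X).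
Definition tstar0 (Sig : Type) (X : tree Sig) : tree Sig :=
  @Tree Sig (tV X) (tE X) (@tsrc Sig X) (@ttgt Sig X) (@tlab Sig X) (ten X) (ten X).

Definition isoclass (Sig : Type) (P : tree Sig -> Prop) : Prop :=
  exists X : tree Sig, is_tree X /\ pruned X /\ nontrivial X /\ P = iso X.

Definition TS (Sig : Type) := {P : tree Sig -> Prop | isoclass P}.

Definition pruned_ops (Sig : Type) (tmul : TS Sig -> TS Sig -> TS Sig)
  (tplus tstar : TS Sig -> TS Sig) : Prop :=
  (forall p q X Y W, sval p X -> sval q Y -> pruned_retract W (tprod X Y) ->
     sval (tmul p q) W) /\
  (forall p X W, sval p X -> pruned_retract W (tplus0 X) -> sval (tplus p) W) /\
  (forall p X W, sval p X -> pruned_retract W (tstar0 X) -> sval (tstar p) W).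

(* Main.v *)
Require Import Defs.
From Stdlib Require Import ZArith Lia.
From mathcomp Require Import all_boot boolp.
Set Implicit Arguments. Unset Strict Implicit. Unset Printing Implicit Defensive.

(* A tree is studied through the relation "some morphism into the labelled
   graph R takes the start vertex to p and the end vertex to q". The three
   operations act on these relations by composition, domain and codomain, two
   trees have isomorphic pruned retracts iff their relations agree for every R,
   and cutting a tree at an edge shows that its relation is that of a
   (2,1,1)-term. Adequacy then follows because directed walks in a tree are
   determined by their ends.

   For freeness, a term must be evaluated in an adequate semigroup S in a way
   that depends only on its relations. Take for R the graph of idempotents of
   S, with an arrow e -a-> f when e <= (a f)^+ and f <= (e a)^*: the morphisms
   from a tree into R are its consistent labellings by idempotents, and a tree
   has a largest labelling of its trunk, from which the value of the term is
   recovered as a product along the trunk. *)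


(** A morphism into the graph of idempotents reports only the labels of the start and end vertices,
    whereas comparing two terms needs the labels along the whole trunk. So the graph is enlarged: a
    vertex also remembers the part of a prescribed labelled trunk still to be read, and a walk of
    the right length that exhausts the prescription must have followed it arc by arc. The right
    length is itself visible to the relations, through the successor graph on the integers. The
    largest labelling of one term thus becomes a labelling of any equivalent term, and maximality in
    both directions makes the two largest labellings, hence the two products, coincide. An identity
    is adjoined to [S] because cutting a tree produces one-vertex pieces, which need a value. *)

(** * Laws of plus and star, duality, and the order on idempotents *)

Record adequate_monoid := AdequateMonoid {
  mcar :> Type;
  mop : mcar -> mcar -> mcar;
  mone : mcar;
  mplus : mcar -> mcar;
  mstar : mcar -> mcar;
  mopA : forall x y z, mop x (mop y z) = mop (mop x y) z;
  mop1x : forall x, mop mone x = x;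
  mopx1 : forall x, mop x mone = x;
  midemC : forall e f, idem mop e -> idem mop f -> mop e f = mop f e;
  mplusI : forall x, idem mop (mplus x);
  mstarI : forall x, idem mop (mstar x);
  mplusK : forall x, mop (mplus x) x = x;
  mstarK : forall x, mop x (mstar x) = x;
  mplus_mulr : forall x y, mplus (mop x y) = mplus (mop x (mplus y));
  mstar_mull : forall x y, mstar (mop x y) = mstar (mop (mstar x) y);
  mplus_id : forall e, idem mop e -> mplus e = e;
  mstar_id : forall e, idem mop e -> mstar e = e }.

(** Reversing the product exchanges [mplus] and [mstar], so each fact about one yields a fact about
    the other. *)
Definition dual_monoid (M : adequate_monoid) : adequate_monoid :=
  @AdequateMonoid M (fun x y => mop y x) (mone M) (@mstar M) (@mplus M)
    (fun x y z => esym (mopA z y x)) (@mopx1 M) (@mop1x M)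
    (fun e f he hf => midemC hf he)
    (@mstarI M) (@mplusI M) (@mstarK M) (@mplusK M)
    (fun x y => mstar_mull y x) (fun x y => mplus_mulr y x)
    (@mstar_id M) (@mplus_id M).

Local Notation "x ** y" := (mop x y) (at level 40, left associativity).
Local Notation idm := (idem (@mop _)).

Definition ile (M : adequate_monoid) (e f : M) : Prop := e ** f = e.

Section IdempotentOrder.
Context (M : adequate_monoid).
Implicit Types e f g a x y : M.

Lemma idem_mul e f : idm e -> idm f -> idm (e ** f).
Proof.
move=> he hf; rewrite /idem mopA -(mopA e f e) (midemC hf he) mopA he -mopA hf //.
Qed.

Lemma idem_one : idm (mone M).
Proof. exact: mop1x. Qed.

Lemma ile_trans f e g : ile e f -> ile f g -> ile e g.
Proof. by rewrite /ile => <- h; rewrite -mopA h. Qed.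

Lemma ile_anti e f : idm e -> idm f -> ile e f -> ile f e -> e = f.
Proof. by rewrite /ile => he hf h1 h2; rewrite -h1 midemC. Qed.

Lemma ile_one e : ile e (mone M). Proof. exact: mopx1. Qed.

Lemma ile_mul e f g : ile e f -> ile e g -> ile e (f ** g).
Proof. by rewrite /ile mopA => -> ->. Qed.

Lemma ile_mulr e f : idm f -> ile (e ** f) f.
Proof. by move=> hf; rewrite /ile -mopA hf. Qed.

Lemma ile_mull e f : idm e -> idm f -> ile (e ** f) e.
Proof. by move=> he hf; rewrite midemC //; apply: ile_mulr. Qed.

Lemma mplus_mull e x : idm e -> mplus (e ** x) = e ** mplus x.
Proof.
by move=> he; rewrite mplus_mulr mplus_id //; apply: idem_mul => //; apply: mplusI.
Qed.

Lemma ile_plus_mul x y : ile (mplus (x ** y)) (mplus x).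
Proof.
rewrite /ile midemC; [|exact: mplusI|exact: mplusI].
by rewrite -mplus_mull ?mopA ?mplusK //; apply: mplusI.
Qed.

Lemma ile_plus_mono a e f :
  idm e -> idm f -> ile e f -> ile (mplus (a ** e)) (mplus (a ** f)).
Proof. by move=> he hf <-; rewrite (midemC he hf) mopA; apply: ile_plus_mul. Qed.

(** Since [e ** a] absorbs [mstar (e ** a)] on the right, lowering the target from [f] to
    [mstar (e ** a) ** f] leaves [e ** a ** f] unchanged. Such lowered targets supply the arrows of
    the idempotent graph. *)
Lemma ile_plus_extend e a f : idm e -> ile e (mplus (a ** f)) ->
  ile e (mplus (a ** (mstar (e ** a) ** f))).
Proof.
move=> he h; rewrite /ile -mplus_mull // !mopA mstarK -mopA mplus_mull //.
Qed.

Lemma mplus_plus x : mplus (mplus x) = mplus x.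
Proof. by rewrite mplus_id //; apply: mplusI. Qed.

Lemma mplus_star x : mplus (mstar x) = mstar x.
Proof. by rewrite mplus_id //; apply: mstarI. Qed.

End IdempotentOrder.

Lemma ile_dual (M : adequate_monoid) (e f : M) : idm e -> idm f ->
  @ile (dual_monoid M) e f <-> ile e f.
Proof. by move=> he hf; rewrite /ile /= midemC. Qed.

Lemma mstar_mulr (M : adequate_monoid) (e x : M) :
  idm e -> mstar (x ** e) = mstar x ** e.
Proof. by move=> he; have := @mplus_mull (dual_monoid M) e x he. Qed.

Lemma ile_star_mono (M : adequate_monoid) (a e f : M) :
  idm e -> idm f -> ile e f -> ile (mstar (e ** a)) (mstar (f ** a)).
Proof.
move=> he hf h; apply/ile_dual; [exact: mstarI|exact: mstarI|].
by apply: (@ile_plus_mono (dual_monoid M)) => //; apply/ile_dual.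
Qed.

Lemma ile_star_extend (M : adequate_monoid) (e a f : M) : idm e ->
  ile e (mstar (f ** a)) -> ile e (mstar ((f ** mplus (a ** e)) ** a)).
Proof.
move=> he h; apply/ile_dual; [done|exact: mstarI|].
by apply: (@ile_plus_extend (dual_monoid M)) => //; apply/ile_dual => //; apply: mstarI.
Qed.

(** * Adjoining an identity to an adequate semigroup *)

Section Adjoin.
Context (S : Type) (mul : S -> S -> S) (plus star : S -> S)
  (adS : adequate mul plus star).

(** Comparing [e e] with [1 e] shows that each idempotent is a left identity for the other, and they
    commute. Identities between values of [plus] thus reduce to [Rstar]. *)
Lemma Rstar_idem_eq e f : idem mul e -> idem mul f -> Rstar mul e f -> e = f.
Proof.
case: adS => _ [hC _] he hf hR.
have h1 : mul e f = f by apply/(hR (Some e) None).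
have h2 : mul f e = e by apply/(hR (Some f) None).
by rewrite -h2 hC.
Qed.

Lemma Lstar_idem_eq e f : idem mul e -> idem mul f -> Lstar mul e f -> e = f.
Proof.
case: adS => _ [hC _] he hf hR.
have h1 : mul f e = f by apply/(hR (Some e) None).
have h2 : mul e f = e by apply/(hR (Some f) None).
by rewrite -h2 hC.
Qed.

Lemma adequate_plusK x : mul (plus x) x = x.
Proof.
by case: adS => _ [_ [/(_ x)[hi hR] _]]; apply/(hR (Some (plus x)) None).
Qed.

Lemma adequate_starK x : mul x (star x) = x.
Proof.
by case: adS => _ [_ [_ /(_ x)[hi hR]]]; apply/(hR (Some (star x)) None).
Qed.

Lemma adequate_plus_id e : idem mul e -> plus e = e.
Proof.
case: adS => _ [_ [/(_ e)[hi hR] _]] he.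
by apply: esym; apply: Rstar_idem_eq.
Qed.

Lemma adequate_star_id e : idem mul e -> star e = e.
Proof.
case: adS => _ [_ [_ /(_ e)[hi hR]]] he.
by apply: esym; apply: Lstar_idem_eq.
Qed.

Lemma adequate_plus_mulr x y : plus (mul x y) = plus (mul x (plus y)).
Proof.
case: adS => hA [_ [hP _]].
apply: Rstar_idem_eq; [by case: (hP (mul x y))|by case: (hP (mul x (plus y)))|].
move=> z w; apply: (iff_trans (iff_sym (proj2 (hP (mul x y)) z w))).
apply: iff_trans (proj2 (hP (mul x (plus y))) z w).
(* [Rstar] is a left congruence: the pair tested on [y] is [z x], [w x], where [lact] turns an
   absent factor into plain [x]. *)
case: (hP y) => _ /(_ (Some (lact mul z x)) (Some (lact mul w x))).
by case: z => [z|]; case: w => [w|] /=; rewrite ?hA.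
Qed.

Lemma adequate_star_mull x y : star (mul x y) = star (mul (star x) y).
Proof.
case: adS => hA [_ [_ hP]].
apply: Lstar_idem_eq; [by case: (hP (mul x y))|by case: (hP (mul (star x) y))|].
move=> z w; apply: (iff_trans (iff_sym (proj2 (hP (mul x y)) z w))).
apply: iff_trans (proj2 (hP (mul (star x) y)) z w).
case: (hP x) => _ /(_ (Some (ract mul y z)) (Some (ract mul y w))).
by case: z => [z|]; case: w => [w|] /=; rewrite -?hA.
Qed.

Definition adjoin_mul (x y : option S) : option S :=
  match x, y with
  | Some x, Some y => Some (mul x y)
  | None, y => y
  | x, None => x
  end.

Lemma idem_adjoin x : idem adjoin_mul (Some x) <-> idem mul x.
Proof. by rewrite /idem /=; split=> [[]|->]. Qed.

(** Transparent, since values of terms in this monoid are later computed by reduction. *)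
Definition adjoin_monoid : adequate_monoid.
Proof.
apply: (@AdequateMonoid (option S) adjoin_mul None (omap plus) (omap star));
  have [hA [hC [hP hS]]] := adS.
- by move=> [x|] [y|] [z|] //=; rewrite hA.
- by [].
- by case.
- by move=> [x|] [y|] // /idem_adjoin hx /idem_adjoin hy /=; rewrite hC.
- by case=> [x|] //; apply/idem_adjoin; case: (hP x).
- by case=> [x|] //; apply/idem_adjoin; case: (hS x).
- by case=> [x|] //=; rewrite adequate_plusK.
- by case=> [x|] //=; rewrite adequate_starK.
- move=> [x|] [y|] //=; first by rewrite adequate_plus_mulr.
  by rewrite (@adequate_plus_id (plus y)) //; case: (hP y).
- move=> [x|] [y|] //=; first by rewrite adequate_star_mull.
  by rewrite (@adequate_star_id (star x)) //; case: (hS x).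
- by case=> [x|] // /idem_adjoin hx /=; rewrite adequate_plus_id.
- by case=> [x|] // /idem_adjoin hx /=; rewrite adequate_star_id.
Defined.

End Adjoin.

(** * Terms, their trunks, and walks in the graph of idempotents *)

Inductive term (Sig : Type) :=
  | TOne | TGen (a : Sig) | TMul (t u : term Sig) | TPlus (t : term Sig)
  | TStar (t : term Sig).
Arguments TOne {Sig}.

Fixpoint thom (Sig : Type) (t : term Sig) (V : Type) (R : V -> Sig -> V -> Prop)
    (p q : V) : Prop :=
  match t with
  | TOne => p = q
  | TGen a => R p a q
  | TMul t u => exists2 r, thom t R p r & thom u R r q
  | TPlus t => p = q /\ exists r, thom t R p r
  | TStar t => p = q /\ exists r, thom t R r q
  end.

Fixpoint term_val (Sig : Type) (M : adequate_monoid) (g : Sig -> M) (t : term Sig) : M :=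
  match t with
  | TOne => mone M
  | TGen a => g a
  | TMul t u => term_val g t ** term_val g u
  | TPlus t => mplus (term_val g t)
  | TStar t => mstar (term_val g t)
  end.

(* [Arc x1 a1 (... (Arc xn an (Tip y)))] stands for the product
   [x1 a1 ... xn an y], where the [xi] and [y] are idempotents. *)
Inductive trunk (Sig M : Type) :=
  | Tip (x : M) | Arc (x : M) (a : Sig) (T : trunk Sig M).
Arguments Tip {Sig M}.
Arguments Arc {Sig M}.

Definition trunk_head (Sig M : Type) (T : trunk Sig M) : M :=
  match T with Tip x => x | Arc x _ _ => x end.

Fixpoint trunk_last (Sig M : Type) (T : trunk Sig M) : M :=
  match T with Tip x => x | Arc _ _ T => trunk_last T end.

Fixpoint trunk_size (Sig M : Type) (T : trunk Sig M) : nat :=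
  match T with Tip _ => 0 | Arc _ _ T => (trunk_size T).+1 end.

Section Trunks.
Context (Sig : Type) (M : adequate_monoid) (g : Sig -> M).
Implicit Types (T U C D : trunk Sig M) (t : term Sig) (a b : Sig) (u v x e f L : M).

Fixpoint trunk_val T : M :=
  match T with Tip x => x | Arc x a T => x ** g a ** trunk_val T end.

Fixpoint trunk_idem T : Prop :=
  match T with Tip x => idm x | Arc x _ T => idm x /\ trunk_idem T end.

Definition trunk_lmul x T : trunk Sig M :=
  match T with Tip y => Tip (x ** y) | Arc y a T => Arc (x ** y) a T end.

Fixpoint trunk_cat T U : trunk Sig M :=
  match T with Tip x => trunk_lmul x U | Arc x a T => Arc x a (trunk_cat T U) end.

(** Only generators contribute arcs and only products join them; a [TPlus] or [TStar] subterm is a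
    side branch, kept as its idempotent value at one vertex. *)
Fixpoint term_trunk t : trunk Sig M :=
  match t with
  | TOne => Tip (mone M)
  | TGen a => Arc (mone M) a (Tip (mone M))
  | TMul t u => trunk_cat (term_trunk t) (term_trunk u)
  | TPlus t => Tip (mplus (term_val g t))
  | TStar t => Tip (mstar (term_val g t))
  end.

Lemma trunk_idem_head T : trunk_idem T -> idm (trunk_head T).
Proof. by case: T => //= x a T []. Qed.

Lemma trunk_cat_idem T U : trunk_idem T -> trunk_idem U -> trunk_idem (trunk_cat T U).
Proof.
elim: T => [x|x a T IH] /=; last by case=> ? ? ?; split=> //; apply: IH.
by case: U => [y|y a U] /= hx; [apply: idem_mul|case=> hy hU; split=> //; apply: idem_mul].
Qed.

Lemma term_trunk_idem t : trunk_idem (term_trunk t).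
Proof.
elim: t => [|a|t IHt u IHu|t IH|t IH] /=; [exact: idem_one| | | |].
- by split; apply: idem_one.
- exact: trunk_cat_idem.
- exact: mplusI.
- exact: mstarI.
Qed.

Lemma trunk_cat_val T U : trunk_val (trunk_cat T U) = trunk_val T ** trunk_val U.
Proof.
elim: T => [x|x a T IH] /=; last by rewrite IH !mopA.
by case: U => [y|y a U] //=; rewrite !mopA.
Qed.

Lemma term_trunk_val t : trunk_val (term_trunk t) = term_val g t.
Proof.
by elim: t => [|a|t IHt u IHu|t IH|t IH] //=; rewrite ?mop1x ?mopx1 // trunk_cat_val IHt IHu.
Qed.

Lemma trunk_cat_size T U : trunk_size (trunk_cat T U) = trunk_size T + trunk_size U.
Proof. by elim: T => [x|x a T IH] /=; [case: U|rewrite IH]. Qed.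

(** Over the integers every vertex has a successor and a predecessor, so side branches impose no
    constraint and the relation shows exactly the trunk length. *)
Lemma thom_shift t (p q : Z) :
  thom t (fun i _ j => j = (i + 1)%Z) p q <->
  q = (p + Z.of_nat (trunk_size (term_trunk t)))%Z.
Proof.
elim: t p q => [|a|t IHt u IHu|t IH|t IH] p q /=.
- lia.
- lia.
- rewrite trunk_cat_size; split.
    by case=> r /IHt hr /IHu ->; rewrite hr Nat2Z.inj_add; lia.
  move=> ->; exists (p + Z.of_nat (trunk_size (term_trunk t)))%Z; first exact/IHt.
  by apply/IHu; rewrite Nat2Z.inj_add; lia.
- split; first by case=> ->; lia.
  move=> ->; split; first lia.
  by eexists; apply/IH.
- split; first by case=> ->; lia.
  move=> ->; split; first lia.
  by exists (p + 0 - Z.of_nat (trunk_size (term_trunk t)))%Z; apply/IH; lia.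
Qed.

(** Applying [mplus] to both labels lets every element of [M] name an idempotent, which spares a
    separate type of idempotents. *)
Definition compat u a v : Prop :=
  ile (mplus u) (mplus (g a ** mplus v)) /\ ile (mplus v) (mstar (mplus u ** g a)).

(* A vertex [(C, u)] carries the idempotent [mplus u], and [C] is the part of a
   prescribed labelled trunk that remains to be read: an edge either stays at
   the same [C] or reads its first arc. *)
Definition state : Type := (trunk Sig M * M)%type.

Definition state_edge (p : state) a (q : state) : Prop :=
  compat p.2 a q.2 /\
  (q.1 = p.1 \/ exists2 x, p.1 = Arc x a q.1 & q.2 = trunk_head q.1).

(** The witness [mstar (mplus p.2 ** g a) ** f] is the largest target below [f] that the arrow
    condition allows. It stays at the same [C], so side branches never depend on the prescribed
    trunk. *)
Lemma state_edge_fwd (p : state) a f : idm f ->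
  (exists2 q, state_edge p a q & ile (mplus q.2) f) <->
  ile (mplus p.2) (mplus (g a ** f)).
Proof.
move=> hf; split.
  move=> [q [[h1 _] _] h2]; apply: ile_trans h1 _.
  by apply: ile_plus_mono => //; apply: mplusI.
move=> h; have hi := mstarI (mplus p.2 ** g a).
have hif : idm (mstar (mplus p.2 ** g a) ** f) by apply: idem_mul.
exists (p.1, mstar (mplus p.2 ** g a) ** f); last first.
  by rewrite /= mplus_id //; apply: ile_mulr.
split; last by left.
rewrite /compat /= (mplus_id hif); split; last exact: ile_mull.
by apply: ile_plus_extend => //; apply: mplusI.
Qed.

Lemma state_edge_bwd (q : state) a f : idm f ->
  (exists2 p, state_edge p a q & ile (mplus p.2) f) <->
  ile (mplus q.2) (mstar (f ** g a)).
Proof.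
move=> hf; split.
  move=> [p [[_ h1] _] h2]; apply: ile_trans h1 _.
  by apply: ile_star_mono => //; apply: mplusI.
move=> h; have hi := mplusI (g a ** mplus q.2).
have hif : idm (f ** mplus (g a ** mplus q.2)) by apply: idem_mul.
exists (q.1, f ** mplus (g a ** mplus q.2)); last first.
  by rewrite /= mplus_id //; apply: ile_mull.
split; last by left.
rewrite /compat /= (mplus_id hif); split; first exact: ile_mulr.
by apply: ile_star_extend => //; apply: mplusI.
Qed.

Lemma ile_mulE e f x : idm f -> idm x -> ile e (f ** x) <-> ile e f /\ ile e x.
Proof.
move=> hf hx; split; last by case; apply: ile_mul.
by move=> h; split; apply: ile_trans h _; [apply: ile_mull|apply: ile_mulr].
Qed.

(** The bound [f] on the far end carries the induction through products: for [TMul t u] the bound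
    handed to [t] is [mplus (term_val g u ** f)]. Taking [f] to be the identity gives domains and
    codomains. *)
Lemma thom_state_range t :
  (forall p f, idm f -> (exists2 q, thom t state_edge p q & ile (mplus q.2) f) <->
     ile (mplus p.2) (mplus (term_val g t ** f))) /\
  (forall q f, idm f -> (exists2 p, thom t state_edge p q & ile (mplus p.2) f) <->
     ile (mplus q.2) (mstar (f ** term_val g t))).
Proof.
elim: t => [|a|t [IHt IHt'] u [IHu IHu']|t [IH IH']|t [IH IH']] /=.
- split=> p f hf; rewrite ?mop1x ?mopx1 ?(mplus_id hf) ?(mstar_id hf).
    by split=> [[q <-]|h] //; exists p.
  by split=> [[q ->]|h] //; exists p.
- by split=> p f hf; [apply: state_edge_fwd|apply: state_edge_bwd].
- split=> p f hf.
    rewrite -mopA mplus_mulr; apply: iff_trans (IHt p _ (mplusI _)); split.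
      by move=> [q [r h1 h2] h3]; exists r => //; apply/(IHu r f hf); exists q.
    by move=> [r h1 /(IHu r f hf) [q h2 h3]]; exists q => //; exists r.
  rewrite mopA mstar_mull; apply: iff_trans (IHu' p _ (mstarI _)); split.
    by move=> [q [r h1 h2] h3]; exists r => //; apply/(IHt' r f hf); exists q.
  by move=> [r h1 /(IHt' r f hf) [q h2 h3]]; exists q => //; exists r.
- have E p : (exists r, thom t state_edge p r) <-> ile (mplus p.2) (mplus (term_val g t)).
    rewrite -[X in ile _ (mplus X)]mopx1; apply: iff_trans (IH p _ (@idem_one _)).
    by split=> [[r h]|[r h _]]; exists r => //; apply: ile_one.
  have hp := mplusI (term_val g t).
  split=> p f hf.
    rewrite (mplus_id (idem_mul hp hf)).
    apply: iff_trans (iff_sym (ile_mulE _ hp hf)); split.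
      by move=> [q [<- /E h1] h2].
    by move=> [/E h1 h2]; exists p.
  rewrite (mstar_id (idem_mul hf hp)).
  apply: iff_trans (iff_sym (ile_mulE _ hf hp)); split.
    by move=> [q [-> /E h1] h2].
  by move=> [h2 /E h1]; exists p.
- have E p : (exists r, thom t state_edge r p) <-> ile (mplus p.2) (mstar (term_val g t)).
    rewrite -[X in ile _ (mstar X)]mop1x; apply: iff_trans (IH' p _ (@idem_one _)).
    by split=> [[r h]|[r h _]]; exists r => //; apply: ile_one.
  have hp := mstarI (term_val g t).
  split=> p f hf.
    rewrite (mplus_id (idem_mul hp hf)).
    apply: iff_trans (iff_sym (ile_mulE _ hp hf)); split.
      by move=> [q [<- /E h1] h2].
    by move=> [/E h1 h2]; exists p.
  rewrite (mstar_id (idem_mul hf hp)).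
  apply: iff_trans (iff_sym (ile_mulE _ hf hp)); split.
    by move=> [q [-> /E h1] h2].
  by move=> [h2 /E h1]; exists p.
Qed.

Lemma thom_state_dom t p :
  (exists q, thom t state_edge p q) <-> ile (mplus p.2) (mplus (term_val g t)).
Proof.
rewrite -[X in ile _ (mplus X)]mopx1.
apply: iff_trans (proj1 (thom_state_range t) p _ (@idem_one _)).
by split=> [[r h]|[r h _]]; exists r => //; apply: ile_one.
Qed.

Lemma thom_state_cod t q :
  (exists p, thom t state_edge p q) <-> ile (mplus q.2) (mstar (term_val g t)).
Proof.
rewrite -[X in ile _ (mstar X)]mop1x.
apply: iff_trans (proj2 (thom_state_range t) q _ (@idem_one _)).
by split=> [[r h]|[r h _]]; exists r => //; apply: ile_one.
Qed.

Fixpoint trunk_walk T (p q : state) : Prop :=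
  match T with
  | Tip x => p = q /\ ile (mplus p.2) x
  | Arc x a T => ile (mplus p.2) x /\ exists2 r, state_edge p a r & trunk_walk T r q
  end.

Lemma trunk_walk_cat T U p q : trunk_idem T -> trunk_idem U ->
  trunk_walk (trunk_cat T U) p q <-> exists2 r, trunk_walk T p r & trunk_walk U r q.
Proof.
move=> + hU; elim: T p => [x|x a T IH] p /=.
  move=> hx.
  have -> : (exists2 r, p = r /\ ile (mplus p.2) x & trunk_walk U r q) <->
            (ile (mplus p.2) x /\ trunk_walk U p q).
    by split=> [[r [<- h1] h2]|[h1 h2]] //; exists p.
  case: U hU => [y|y a U] /=; last case=> hy hU.
    by move=> hy; rewrite ile_mulE //; tauto.
  by rewrite ile_mulE //; tauto.
case=> hx hT; split.
  by move=> [h1 [r h2 /(IH r hT) [s h3 h4]]]; exists s => //; split=> //; exists r.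
move=> [s [h1 [r h2 h3]] h4]; split=> //; exists r => //; apply/IH => //; by exists s.
Qed.

(** By [thom_state_dom] and [thom_state_cod] a side branch can be placed at a vertex exactly when
    the label lies below its value, so branches reduce to the bounds stored along the trunk. *)
Lemma thom_trunk_walk t p q :
  thom t state_edge p q <-> trunk_walk (term_trunk t) p q.
Proof.
elim: t p q => [|a|t IHt u IHu|t IH|t IH] p q /=.
- by split=> [->|[]] //; split=> //; apply: ile_one.
- split=> [h|[_ [r h [<- _]]]] //; split; first exact: ile_one.
  by exists q => //; split=> //; apply: ile_one.
- apply: iff_trans (iff_sym (trunk_walk_cat _ _ (term_trunk_idem _) (term_trunk_idem _))).
  by split=> -[r /IHt h1 /IHu h2]; exists r.
- by split=> -[-> /thom_state_dom h].
- by split=> -[-> /thom_state_cod h].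
Qed.

End Trunks.

(** * The largest labelling of a trunk *)

Section Canonical.
Context (Sig : Type) (M : adequate_monoid) (g : Sig -> M).
Implicit Types (T U C D : trunk Sig M) (t : term Sig) (a b : Sig) (u v x e f L : M).

(* The value at a trunk vertex combines everything read before it, through
   [mstar], and everything that remains to be read, through [mplus]. *)
Fixpoint trunk_canon L T : trunk Sig M :=
  match T with
  | Tip x => Tip (mstar L ** mplus x)
  | Arc x a U => Arc (mstar L ** mplus (x ** g a ** trunk_val g U)) a
                     (trunk_canon (L ** g a ** trunk_head U) U)
  end.

Lemma trunk_canon_head L T :
  trunk_head (trunk_canon L T) = mstar L ** mplus (trunk_val g T).
Proof. by case: T. Qed.

Lemma trunk_canon_idem L T : trunk_idem (trunk_canon L T).
Proof.
elim: T L => [x|x a T IH] L /=; last split=> //.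
  by apply: idem_mul; [apply: mstarI|apply: mplusI].
by apply: idem_mul; [apply: mstarI|apply: mplusI].
Qed.

Lemma trunk_canon_size L T : trunk_size (trunk_canon L T) = trunk_size T.
Proof. by elim: T L => //= x a T IH L; rewrite IH. Qed.

Lemma trunk_head_val T : trunk_idem T -> trunk_head T ** trunk_val g T = trunk_val g T.
Proof. by case: T => [x|x a T] //= [hx _]; rewrite !mopA hx. Qed.

(** [C] lists the labels of a labelled trunk, and the entries of [T] are their upper bounds, one for
    the side branches at each vertex. *)
Fixpoint fits C T : Prop :=
  match C, T with
  | Tip u, Tip x => ile (mplus u) x
  | Arc u a C, Arc x b T =>
      [/\ ile (mplus u) x, a = b, compat g u a (trunk_head C) & fits C T]
  | _, _ => False
  end.

Section CanonStep.
Context (L x A y W : M) (hx : idm x) (hy : idm y) (hL : L ** x = L) (hW : y ** W = W).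

(** [E0] and [E1] are the canonical labels at the two ends of one arc: [L] is the product read up to
    the bound [x], [A] the letter, and [W] the remaining product, which starts with the bound
    [y]. *)
Let E0 := mstar L ** mplus (x ** A ** W).
Let E1 := mstar (L ** A ** y) ** mplus W.

Lemma canon_step_absorb : mstar L ** x = mstar L.
Proof. by rewrite -mstar_mulr // hL. Qed.

Lemma canon_step_head : E0 = mstar L ** mplus (A ** W).
Proof.
by rewrite /E0 -mopA mplus_mull // mopA canon_step_absorb.
Qed.

(** Writing [mplus W] as [y ** mplus W] brings [mstar (L ** A ** y)] next to an element that absorbs
    it, and [mplus (A ** W)] is absorbed by [A ** mplus W]. Both labels can then be read off this
    product, by [mplus] and by [mstar]. *)
Lemma canon_step_mul : E0 ** A ** E1 = mstar L ** A ** mplus W.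
Proof.
have hs := mstarI (L ** A ** y).
have yW : y ** mplus W = mplus W by rewrite -mplus_mull // hW.
have sE : mstar (L ** A ** y) = mstar (mstar L ** A ** y).
  by rewrite -mopA mstar_mull mopA.
set s := mstar (L ** A ** y); set Z := mstar L ** A ** y.
have Zs : Z ** s = Z by rewrite /s sE mstarK.
have -> : E0 ** A ** E1 = mplus (A ** W) ** (Z ** s) ** mplus W.
  rewrite canon_step_head /E1 -/s (midemC (mstarI L) (mplusI _)) -{1}yW.
  by rewrite (mopA s) (midemC hs hy) !mopA.
rewrite Zs /Z -!mopA yW mopA (midemC (mplusI _) (mstarI L)) -mopA; congr (_ ** _).
by rewrite mplus_mulr mplusK.
Qed.

Lemma canon_step_plus : mplus (E0 ** A ** E1) = E0.
Proof.
rewrite canon_step_mul -mopA mplus_mull; last exact: mstarI.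
by rewrite -mplus_mulr -canon_step_head.
Qed.

Lemma canon_step_star : mstar (E0 ** A ** E1) = E1.
Proof.
have yW : y ** mplus W = mplus W by rewrite -mplus_mull // hW.
rewrite canon_step_mul -yW mopA mstar_mulr; last exact: mplusI.
by rewrite /E1 -(mopA L) [mstar (L ** _)]mstar_mull mopA.
Qed.

Lemma canon_step_idem : idm E0 /\ idm E1.
Proof.
by split; apply: idem_mul; [apply: mstarI|apply: mplusI|apply: mstarI|apply: mplusI].
Qed.

Lemma canon_step_compat :
  ile (mplus E0) (mplus (A ** mplus E1)) /\ ile (mplus E1) (mstar (mplus E0 ** A)).
Proof.
case: canon_step_idem => h0 h1; rewrite !(mplus_id h0) !(mplus_id h1); split.
  by rewrite /ile -mplus_mull // mopA canon_step_plus.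
by rewrite /ile (midemC h1 (mstarI _)) -mstar_mulr // canon_step_star.
Qed.

Lemma canon_step_val :
  E0 ** A ** (mstar (L ** A ** y) ** W) = mstar L ** (x ** A ** W).
Proof.
have -> : mstar (L ** A ** y) ** W = E1 ** W by rewrite /E1 -(mopA _ (mplus W)) mplusK.
by rewrite mopA canon_step_mul -(mopA _ (mplus W)) mplusK !mopA canon_step_absorb.
Qed.

End CanonStep.

Lemma trunk_canon_fits L T : trunk_idem T -> L ** trunk_head T = L ->
  fits (trunk_canon L T) T.
Proof.
elim: T L => [x|x a T IH] L /=.
  move=> hx hL; rewrite (mplus_id hx) -mstar_mulr // hL mplus_star.
  by rewrite /ile -mstar_mulr // hL.
case=> hx hT hL; have hi := trunk_idem_head hT.
have hW := trunk_head_val hT.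
split=> //.
- rewrite mplus_id; last by apply: idem_mul; [apply: mstarI|apply: mplusI].
  apply: ile_trans (ile_mulr _ (mplusI _)) _.
  by rewrite -mopA -[X in ile _ X](mplus_id hx); apply: ile_plus_mul.
- by rewrite /compat trunk_canon_head; apply: canon_step_compat.
- by apply: IH => //; rewrite -mopA hi.
Qed.

Lemma trunk_canon_val L T : trunk_idem T -> L ** trunk_head T = L ->
  trunk_val g (trunk_canon L T) = mstar L ** trunk_val g T.
Proof.
elim: T L => [x|x a T IH] L /=; first by move=> /mplus_id ->.
case=> hx hT hL; have hi := trunk_idem_head hT.
rewrite IH //; last by rewrite -mopA hi.
by apply: canon_step_val => //; apply: trunk_head_val.
Qed.

Fixpoint trunk_le C D : Prop :=
  match C, D with
  | Tip u, Tip x => ile u x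
  | Arc u a C, Arc x b D => [/\ ile u x, a = b & trunk_le C D]
  | _, _ => False
  end.

Lemma trunk_le_anti C D : trunk_idem C -> trunk_idem D ->
  trunk_le C D -> trunk_le D C -> C = D.
Proof.
elim: C D => [u|u a C IH] [x|x b D] //=; first by move=> hu hx h1 h2; rewrite (ile_anti hu hx).
by move=> [hu hC] [hx hD] [h1 <- h2] [h3 _ h4]; rewrite (ile_anti hu hx) // (IH D).
Qed.

Lemma fits_head C T : idm (trunk_head C) -> fits C T -> ile (trunk_head C) (trunk_head T).
Proof.
case: C T => [u|u a C] [x|x b T] //= /mplus_id E; first by rewrite E.
by case; rewrite E.
Qed.

Lemma fits_plus C T : trunk_idem T -> fits C T ->
  ile (mplus (trunk_head C)) (mplus (trunk_val g T)).
Proof.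
elim: C T => [u|u a C IH] [x|x b T] //=; first by move=> /mplus_id ->.
move=> [hx hT] [h1 <- [h2 _] h3].
rewrite -mopA mplus_mull // mplus_mulr; apply: ile_mul => //.
by apply: ile_trans h2 _; apply: ile_plus_mono (IH T hT h3); apply: mplusI.
Qed.

(** Compatibility works in both directions: from the end backwards it bounds each label by the
    [mplus] of what remains, from the start forwards by the [mstar] of what was read. The canonical
    label is the meet of the two bounds. *)
Lemma fits_le_canon C T L : trunk_idem C -> trunk_idem T ->
  fits C T -> ile (trunk_head C) (mstar L) -> trunk_le C (trunk_canon L T).
Proof.
elim: C T L => [u|u a C IH] [x|x b T] L //=.
  by move=> hu hx; rewrite (mplus_id hu) (mplus_id hx) => h1 h2; apply: ile_mul.
move=> [hu hC] [hx hT] hf hL.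
have hP := @fits_plus (Arc u a C) (Arc x b T) (conj hx hT) hf.
move: hf hP => /= [h1 <- [_ h2] h3]; rewrite (mplus_id hu) => h4.
have hi := trunk_idem_head hC; have hj := trunk_idem_head hT.
split=> //; first exact: ile_mul.
apply: IH => //.
rewrite (mplus_id hu) (mplus_id hi) in h2.
rewrite -mopA mstar_mull mopA mstar_mulr //; apply: ile_mul.
  by apply: ile_trans h2 _; apply: ile_star_mono => //; apply: mstarI.
exact: fits_head h3.
Qed.

Lemma fits_trunk_walk C T : fits C T ->
  trunk_walk g T (C, trunk_head C) (Tip (trunk_last C), trunk_last C).
Proof.
elim: C T => [u|u a C IH] [x|x b T] //= [h1 <- h2 h3].
split=> //; exists (C, trunk_head C); last exact: IH.
by split=> //=; right; exists u.
Qed.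

Lemma trunk_walk_size T (p : state Sig M) z w :
  trunk_walk g T p (Tip z, w) -> trunk_size p.1 <= trunk_size T.
Proof.
elim: T p => [x|x a T IH] p /=; first by case=> ->.
case=> _ [r [_ [<-|[y -> _]]] /IH] //; exact: leqW.
Qed.

(** Each arc of [T] consumes at most one arc of [C], and the walk ends with [C] exhausted. With
    equal sizes no step may stay, so every label is the prescribed one. *)
Lemma trunk_walk_fits T C z w : trunk_size T = trunk_size C ->
  trunk_walk g T (C, trunk_head C) (Tip z, w) -> fits C T.
Proof.
elim: T C => [x|x a T IH] [u|u b C] //=; first by move=> _ [].
move=> [hs] [h1 [[C' v] [h2 h3] h4]] /=.
have hsz := trunk_walk_size h4.
case: h3 h2 h4 hsz => /= [->|[y [Eu Eb EC] Ev]] h2 h4 hsz.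
  by move: hsz; rewrite /= hs ltnn.
by subst; split=> //; apply: IH.
Qed.

End Canonical.

(** * Equivalent terms have equal values *)

Definition term_equiv (Sig : Type) (t u : term Sig) : Prop :=
  forall (V : Type) (R : V -> Sig -> V -> Prop) (p q : V), thom t R p q <-> thom u R p q.

Section Soundness.
Context (Sig : Type) (M : adequate_monoid) (g : Sig -> M).

(** Taking [L] to be the head meets the invariant [L ** trunk_head T = L], and its [mstar] is
    absorbed by the product. *)
Definition term_canon (t : term Sig) : trunk Sig M :=
  let T := term_trunk g t in trunk_canon g (trunk_head T) T.

Lemma term_canon_val t : trunk_val g (term_canon t) = term_val g t.
Proof.
have hT := term_trunk_idem g t; have hi := trunk_idem_head hT.
rewrite trunk_canon_val // (mstar_id hi) trunk_head_val //; exact: term_trunk_val.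
Qed.

Lemma term_equiv_size t u :
  term_equiv t u -> trunk_size (term_trunk g t) = trunk_size (term_trunk g u).
Proof.
move=> h; set n := trunk_size _.
have /h/(thom_shift g) : thom t (fun i _ j => j = (i + 1)%Z) 0%Z (Z.of_nat n).
  exact/(thom_shift g).
lia.
Qed.

Lemma term_equiv_canon_le t u : term_equiv t u -> trunk_le (term_canon t) (term_canon u).
Proof.
move=> h; have hT := term_trunk_idem g t; have hU := term_trunk_idem g u.
have hi := trunk_idem_head hT; have hj := trunk_idem_head hU.
have hft : fits g (term_canon t) (term_trunk g t) by apply: trunk_canon_fits.
have hfu : fits g (term_canon t) (term_trunk g u).
  (* Only the relation between the two end states passes from [t] to [u]; the labels travel inside
     the start state. *)
  move: (fits_trunk_walk hft) => /thom_trunk_walk/h/thom_trunk_walk.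
  by apply: trunk_walk_fits; rewrite trunk_canon_size (term_equiv_size h).
have hc := trunk_canon_idem g (trunk_head (term_trunk g t)) (term_trunk g t).
apply: fits_le_canon => //; rewrite (mstar_id hj).
exact: fits_head (trunk_idem_head hc) hfu.
Qed.

Lemma term_equiv_val t u : term_equiv t u -> term_val g t = term_val g u.
Proof.
move=> h; rewrite -!term_canon_val; congr (trunk_val g _).
by apply: trunk_le_anti; rewrite ?/term_canon; try exact: trunk_canon_idem;
  apply: term_equiv_canon_le => // V R p q; apply: iff_sym.
Qed.

End Soundness.

(** * Undirected and directed walks in a tree *)

Section Walks.
Context (Sig : Type) (X : tree Sig).
Implicit Types (u v m : tV X) (w : seq (tE X * bool)) (e d : tE X) (es : seq (tE X)).

Lemma uwalk_cat u w1 w2 v :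
  uwalk u (w1 ++ w2) v <-> exists2 m, uwalk u w1 m & uwalk m w2 v.
Proof.
elim: w1 u => [|s w1 IH] u /=; first by split=> [h|[m <-]] //; exists u.
split; first by case=> h1 /IH [m h2 h3]; exists m.
by case=> m [h1 h2] h3; split=> //; apply/IH; exists m.
Qed.

Lemma uwalk_end u w v v' : uwalk u w v -> uwalk u w v' -> v = v'.
Proof. by elim: w u => [|s w IH] u /= => [<- //|[_ /IH h] [_ /h]]. Qed.

Lemma uwalk_shorten u w v : uwalk u w v ->
  exists w', [/\ uwalk u w' v, uniq (map fst w') & {subset map fst w' <= map fst w}].
Proof.
elim: w u => [|[e b] w IH] u /=; first by move=> h; exists [::].
case=> hu /IH [w' [h1 h2 h3]].
have [he|he] := boolP (e \in map fst w'); last first.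
  exists ((e, b) :: w'); split=> //=; first by rewrite he.
  by move=> d; rewrite !inE => /orP[->//|/h3 ->]; rewrite orbT.
case/mapP: he => -[e' c] /= hin E; subst e'; case/splitPr: hin h1 h2 h3 => wa wb.
move=> /uwalk_cat [m h1 /= [h2 h4]].
rewrite map_cat cat_uniq => /and3P[_ _ /= /andP[he hb]] h3.
have hs : {subset map fst wb <= e :: map fst w}.
  by move=> d hd; rewrite inE h3 ?orbT // mem_cat inE hd !orbT.
(* If [e] recurs in the same direction, the loop between the crossings is cut out; if in the
   opposite one, both crossings are dropped and the walk resumes from [u]. *)
have [hbc|hbc] := eqVneq b c.
  exists ((e, b) :: wb); split=> /=; [by rewrite {2}hbc|by rewrite he|].
  by move=> d; rewrite inE => /predU1P[->|/hs //]; rewrite mem_head.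
exists wb; split=> //; rewrite -hu; move: h4.
by case: b c hbc {hu h1 h2} => -[].
Qed.

(** Deleting [e] separates its ends: [side] holds at the vertices reachable from [ttgt e] without
    [e], and reaching [tsrc e] in this way would close a cycle. *)
Lemma acyclic_side e : acyclic X ->
  exists side : tV X -> bool, [/\ side (tsrc e) = false, side (ttgt e) &
    forall d, d != e -> side (tsrc d) = side (ttgt d)].
Proof.
move=> hX.
exists (fun v => `[< exists2 w, uwalk (ttgt e) w v & e \notin map fst w >]); split.
- apply/asboolP => -[w /uwalk_shorten [w' [h1 h2 h3]] h4].
  have := hX (tsrc e) ((e, true) :: w') (conj erefl h1).
  rewrite /= h2 andbT => h; have := h _; rewrite (contra (h3 e) h4).
  by move=> /(_ isT).
- by apply/asboolP; exists [::].
- move=> d hd; apply/asbool_equiv_eq; split=> -[w h1 h2].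
    exists (rcons w (d, true)); last by rewrite map_rcons mem_rcons inE eq_sym negb_or hd.
    by rewrite -cats1; apply/uwalk_cat; exists (tsrc d).
  exists (rcons w (d, false)); last by rewrite map_rcons mem_rcons inE eq_sym negb_or hd.
  by rewrite -cats1; apply/uwalk_cat; exists (ttgt d).
Qed.

Definition darc u es v : Prop := uwalk u [seq (e, true) | e <- es] v.

Lemma darc_cat u es1 es2 v :
  darc u (es1 ++ es2) v <-> exists2 m, darc u es1 m & darc m es2 v.
Proof. by rewrite /darc map_cat; apply: uwalk_cat. Qed.

(** A directed walk crosses [e] only from the false side to the true one, so its ends fix the number
    of crossings. *)
Lemma darc_count (side : tV X -> bool) e :
  side (tsrc e) = false -> side (ttgt e) ->
  (forall d, d != e -> side (tsrc d) = side (ttgt d)) ->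
  forall u es v, darc u es v -> side u + count_mem e es = side v.
Proof.
move=> h0 h1 h2 u es v; elim: es u => [|d es IH] u /=; first by move=> <-; rewrite addn0.
case=> <- /IH <-; have [->|/h2 ->] := eqVneq d e; last by rewrite add0n.
by rewrite h0 h1.
Qed.

Lemma darc_loop u es : acyclic X -> darc u es u -> es = [::].
Proof.
move=> hX; case: es => [//|e es] h.
have [side [h0 h1 h2]] := acyclic_side e hX.
by have := darc_count h0 h1 h2 h; rewrite /= eqxx; case: (side u) => //= -[].
Qed.

Lemma darc_uniq u es es' v : acyclic X -> darc u es v -> darc u es' v -> es = es'.
Proof.
move=> hX; elim: es es' u => [|d es IH] es' u h h'.
  by move: h'; rewrite -(h : u = v) => /(darc_loop hX) ->.
case: es' h' => [|d' es'] h'; first by move: h; rewrite -(h' : u = v) => /(darc_loop hX).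
have [Ed|dd'] := eqVneq d d'.
  by subst d'; congr (_ :: _); apply: IH (proj2 h) (proj2 h').
have [side [h0 h1 h2]] := acyclic_side d hX.
have := darc_count h0 h1 h2 h; rewrite -(darc_count h0 h1 h2 h') => /addnI /=.
rewrite eqxx eq_sym (negbTE dd') /= add0n => E.
have : d \in es' by rewrite -has_pred1 has_count -E.
move=> hin; case/splitPr: hin h' {E} => e1 e2 [h3 /darc_cat [m h4 [h5 _]]].
(* The second walk also uses [d], whose source is [u]; its part before [d] would be a nonempty
   closed directed walk. *)
suff: d' :: e1 = [::] by [].
apply: (darc_loop hX (u := u)); split=> //.
by move: h h4 => [/= <- _]; rewrite -h5.
Qed.

Lemma darc_mid u v m m' a b a' b' : acyclic X ->
  darc u a m -> darc m b v -> darc u a' m' -> darc m' b' v ->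
  size a = size a' \/ size b = size b' -> m = m'.
Proof.
move=> hX h1 h2 h3 h4 hs.
have E : a ++ b = a' ++ b'.
  by apply: (darc_uniq (u := u) (v := v)) => //; apply/darc_cat; [exists m|exists m'].
have hs' : size a = size a'.
  by case: hs => // hs; have := congr1 size E; rewrite !size_cat hs => /addIn.
move/eqP: E; rewrite eqseq_cat // => /andP[/eqP Ea _]; subst a'.
exact: uwalk_end h1 h3.
Qed.

Lemma uwalk_dir u w v : all (fun s => s.2) w -> uwalk u w v -> darc u (map fst w) v.
Proof.
by rewrite /darc; elim: w u => [|[e []] w IH] u //= h [h1 h2]; split=> //; apply: IH.
Qed.

Lemma is_tree_trunk : is_tree X -> exists es, darc (tst X) es (ten X).
Proof. by case=> _ [_ [w [h1 h2]]]; exists (map fst w); apply: uwalk_dir. Qed.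

End Walks.

(** * Cutting a tree at its edges into a term *)

Section TermOfTree.
Context (Sig : Type) (X : tree Sig).
Implicit Types (u v s t : tV X) (w : seq (tE X * bool)) (e d : tE X) (es : seq (tE X)).
Implicit Types (F : {set tE X}).

(* Homomorphisms of the subgraph with edge set [F] and base points [s], [t];
   vertices not incident to [F] are irrelevant, so all of [tV X] is kept. *)
Definition subhom F s t (V : Type) (R : V -> Sig -> V -> Prop) (p q : V) : Prop :=
  exists f : tV X -> V,
    [/\ forall e, e \in F -> R (f (tsrc e)) (tlab e) (f (ttgt e)), f s = p & f t = q].

Definition reaches F s : Prop :=
  forall e, e \in F -> exists2 w, uwalk s w (tsrc e) & {subset map fst w <= F}.

Definition half (e : tE X) (side : tV X -> bool) (b : bool) F : {set tE X} :=
  [set d in F | (d != e) && (side (tsrc d) == b)].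

Definition base (e : tE X) (b : bool) : tV X := if b then ttgt e else tsrc e.

Section Split.
Context (F : {set tE X}) (e : tE X) (side : tV X -> bool).
Context (s0 : side (tsrc e) = false) (s1 : side (ttgt e)).
Context (sE : forall d, d != e -> side (tsrc d) = side (ttgt d)) (eF : e \in F).

(** Collapsing the other side onto the end of [e] projects walks of [F] to walks of the half, so
    each half stays connected to its base point. *)
Definition to_half (b : bool) (v : tV X) : tV X := if side v == b then v else base e b.

Lemma uwalk_to_half b u w v : {subset map fst w <= F} -> uwalk u w v ->
  uwalk (to_half b u) [seq x <- w | x.1 \in half e side b F] (to_half b v).
Proof.
elim: w u => [|[d c] w IH] u /= hF; first by move=> ->.
have hd : d \in F by apply: hF; rewrite mem_head.
have hw : {subset map fst w <= F} by move=> x hx; apply: hF; rewrite inE hx orbT.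
case=> <- /(IH _ hw) h; rewrite inE hd /=.
have [Ed|de] := eqVneq d e; last case: eqP => [sb|/eqP sb] /=.
- subst d; move: h {IH}; rewrite /to_half /base /=.
  by case: (c); case: b; rewrite ?s0 ?s1.
- have [Es Et] : to_half b (tsrc d) = tsrc d /\ to_half b (ttgt d) = ttgt d.
    by rewrite /to_half -(sE de) sb eqxx.
  by split; [case: (c)|move: h; case: (c); rewrite ?Es ?Et].
- have E : to_half b (tsrc d) = to_half b (ttgt d).
    by rewrite /to_half -(sE de) (negbTE sb).
  by move: h; case: (c); rewrite E.
Qed.

Lemma reaches_to_half b s : reaches F s -> reaches (half e side b F) (to_half b s).
Proof.
move=> hR d; rewrite inE => /and3P[dF de /eqP sb].
have [w h1 h2] := hR d dF.
exists [seq x <- w | x.1 \in half e side b F].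
  by have := uwalk_to_half b h2 h1; rewrite {2}/to_half sb eqxx.
by move=> x /mapP[y]; rewrite mem_filter => /andP[hy _] ->.
Qed.

Lemma card_half b : #|half e side b F| < #|F|.
Proof.
apply: proper_card; apply/properP; split.
  by apply/subsetP => d; rewrite inE => /andP[].
by exists e => //; rewrite inE eqxx andbF.
Qed.

Lemma subhom_glue (V : Type) (R : V -> Sig -> V -> Prop) (f0 f1 : tV X -> V) :
  (forall d, d \in half e side false F -> R (f0 (tsrc d)) (tlab d) (f0 (ttgt d))) ->
  (forall d, d \in half e side true F -> R (f1 (tsrc d)) (tlab d) (f1 (ttgt d))) ->
  R (f0 (tsrc e)) (tlab e) (f1 (ttgt e)) ->
  forall d, d \in F -> R (if side (tsrc d) then f1 (tsrc d) else f0 (tsrc d)) (tlab d)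
                        (if side (ttgt d) then f1 (ttgt d) else f0 (ttgt d)).
Proof.
move=> h0 h1 hR d dF.
have [->|de] := eqVneq d e; first by rewrite s0 s1.
rewrite -(sE de); case sd: (side _); [apply: h1|apply: h0]; by rewrite inE dF de sd.
Qed.

(* The three ways the start and end vertices can sit around [e]. *)
Lemma subhom_split_trunk s t (V : Type) (R : V -> Sig -> V -> Prop) p q :
  side s = false -> side t ->
  subhom F s t R p q <->
  exists2 r, subhom (half e side false F) s (tsrc e) R p r &
  exists2 r', R r (tlab e) r' & subhom (half e side true F) (ttgt e) t R r' q.
Proof.
move=> hs ht; split.
  move=> [f [hf <- <-]]; exists (f (tsrc e)).
    by exists f; split=> // d; rewrite inE => /andP[/hf].
  exists (f (ttgt e)); first exact: hf.
  by exists f; split=> // d; rewrite inE => /andP[/hf].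
move=> [r [f0 [h0 <- <-]] [r' hR [f1 [h1 E <-]]]]; rewrite -E in hR.
exists (fun v => if side v then f1 v else f0 v).
by split; [exact: (@subhom_glue V R f0 f1 h0 h1 hR)|rewrite hs|rewrite ht].
Qed.

Lemma subhom_split_out (V : Type) (R : V -> Sig -> V -> Prop) p q :
  subhom F (tsrc e) (tsrc e) R p q <->
  p = q /\ exists2 r, subhom (half e side false F) (tsrc e) (tsrc e) R p p &
    R p (tlab e) r /\ exists r', subhom (half e side true F) (ttgt e) (ttgt e) R r r'.
Proof.
split.
  move=> [f [hf <- <-]]; split=> //; exists (f (ttgt e)).
    by exists f; split=> // d; rewrite inE => /andP[/hf].
  split; first exact: hf.
  exists (f (ttgt e)).
  by exists f; split=> // d; rewrite inE => /andP[/hf].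
move=> [<- [r [f0 [h0 E0 _]] [hR [r' [f1 [h1 E1 _]]]]]]; rewrite -E0 -E1 in hR.
exists (fun v => if side v then f1 v else f0 v).
by split; [exact: (@subhom_glue V R f0 f1 h0 h1 hR)|rewrite s0|rewrite s0].
Qed.

Lemma subhom_split_in (V : Type) (R : V -> Sig -> V -> Prop) p q :
  subhom F (ttgt e) (ttgt e) R p q <->
  p = q /\ exists2 r, subhom (half e side true F) (ttgt e) (ttgt e) R p p &
    R r (tlab e) p /\ exists r', subhom (half e side false F) (tsrc e) (tsrc e) R r' r.
Proof.
split.
  move=> [f [hf <- <-]]; split=> //; exists (f (tsrc e)).
    by exists f; split=> // d; rewrite inE => /andP[/hf].
  split; first exact: hf.
  exists (f (tsrc e)).
  by exists f; split=> // d; rewrite inE => /andP[/hf].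
move=> [<- [r [f1 [h1 E1 _]] [hR [r' [f0 [h0 _ E0]]]]]]; rewrite -E0 -E1 in hR.
exists (fun v => if side v then f1 v else f0 v).
by split; [exact: (@subhom_glue V R f0 f1 h0 h1 hR)|rewrite s1|rewrite s1].
Qed.

End Split.

Lemma subhom_loop F s (V : Type) (R : V -> Sig -> V -> Prop) p q :
  subhom F s s R p q -> p = q.
Proof. by case=> f [_ <- <-]. Qed.

(** Induction on the number of edges. A trunk is cut at its first edge, as [T0 a T1]; once it is
    empty, an edge at the base point is cut off as an outgoing branch [T0 (a T1)^+] or an incoming
    one [T1 (T0 a)^*]. *)
Lemma subhom_term F s t es : acyclic X -> reaches F s ->
  darc s es t -> {subset es <= F} ->
  exists T : term Sig, forall V R (p q : V), thom T R p q <-> subhom F s t R p q.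
Proof.
move=> hX; have [n] := ubnP #|F|.
elim: n F s t es => [//|n IH] F s t es; rewrite ltnS => hn hr hes hF.
case: es hes hF => [|e es] hes hF.
  move: hes; rewrite /darc /= => <-.
  have [F0|[d dF]] := set_0Vmem F.
    exists TOne => V R p q /=; split; last exact: subhom_loop.
    by move=> ->; exists (fun _ => q); split=> // e; rewrite F0 inE.
  have [e eF [Es|Es]] : exists2 e, e \in F & tsrc e = s \/ ttgt e = s.
  + have [[|[e []] w] h1 h2] := hr d dF.
    - by exists d => //; left.
    - by exists e; [apply: h2; rewrite mem_head|left; case: h1].
    - by exists e; [apply: h2; rewrite mem_head|right; case: h1].
  + subst s; have [side [s0 s1 sE]] := acyclic_side e hX.
    have base_half b : to_half e side b (tsrc e) = base e b.
      by rewrite /to_half s0; case: b.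
    have sub b : exists T : term Sig, forall V R (p q : V), thom T R p q <->
        subhom (half e side b F) (base e b) (base e b) R p q.
      apply: (IH _ _ _ [::]) => //; last by rewrite -base_half; apply: reaches_to_half.
      exact: leq_trans (card_half _ eF b) hn.
    have [T0 H0] := sub false; have [T1 H1] := sub true.
    exists (TMul T0 (TPlus (TMul (TGen (tlab e)) T1))) => V R p q.
    apply: iff_trans (iff_sym (subhom_split_out s0 s1 sE eF R p q)); split.
      move=> [m /H0 h1 [Em [r' [r h2 /H1 h3]]]].
      have Ep := subhom_loop h1; subst m q; split=> //.
      by exists r => //; split=> //; exists r'.
    move=> [-> [r h1 [h2 [r' h3]]]]; exists q; first exact/H0.
    by split=> //; exists r'; exists r => //; apply/H1.
  + subst s; have [side [s0 s1 sE]] := acyclic_side e hX.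
    have base_half b : to_half e side b (ttgt e) = base e b.
      by rewrite /to_half s1; case: b.
    have sub b : exists T : term Sig, forall V R (p q : V), thom T R p q <->
        subhom (half e side b F) (base e b) (base e b) R p q.
      apply: (IH _ _ _ [::]) => //; last by rewrite -base_half; apply: reaches_to_half.
      exact: leq_trans (card_half _ eF b) hn.
    have [T0 H0] := sub false; have [T1 H1] := sub true.
    exists (TMul T1 (TStar (TMul T0 (TGen (tlab e))))) => V R p q.
    apply: iff_trans (iff_sym (subhom_split_in s0 s1 sE eF R p q)); split.
      move=> [m /H1 h1 [Em [r' [r /H0 h3 h2]]]].
      have Ep := subhom_loop h1; subst m q.
      by split=> //; exists r => //; split=> //; exists r'.
    move=> [-> [r h1 [h2 [r' h3]]]]; exists q; first exact/H1.
    by split=> //; exists r'; exists r => //; apply/H0.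
have eF : e \in F by apply: hF; rewrite mem_head.
have [side [s0 s1 sE]] := acyclic_side e hX.
have st : side t.
  by have := darc_count s0 s1 sE hes; rewrite /= eqxx; case: (side t); case: (side s).
have Es : tsrc e = s by case: hes.
subst s.
have base_half b : to_half e side b (tsrc e) = base e b.
  by rewrite /to_half s0; case: b.
have [T0 H0] : exists T : term Sig, forall V R (p q : V), thom T R p q <->
    subhom (half e side false F) (tsrc e) (tsrc e) R p q.
  apply: (IH _ _ _ [::]) => //; last first.
    by have := reaches_to_half s0 s1 sE (b := false) hr; rewrite base_half.
  exact: leq_trans (card_half _ eF _) hn.
have [T1 H1] : exists T : term Sig, forall V R (p q : V), thom T R p q <->
    subhom (half e side true F) (ttgt e) t R p q.
  (* The rest of the trunk is the projection of the whole trunk to the target half, where the filter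
     removes [e]. *)
  apply: (IH _ _ _ [seq d <- e :: es | d \in half e side true F]).
  - exact: leq_trans (card_half _ eF _) hn.
  - by have := reaches_to_half s0 s1 sE (b := true) hr; rewrite base_half.
  - rewrite -[ttgt e](base_half true).
    have -> : t = to_half e side true t by rewrite /to_half st.
    rewrite /darc.
    have -> : [seq (d, true) | d <- [seq d <- e :: es | d \in half e side true F]] =
        [seq x <- [seq (d, true) | d <- e :: es] | x.1 \in half e side true F].
      by rewrite filter_map.
    apply: uwalk_to_half => // x.
    by rewrite -map_comp map_id_in //; apply: hF.
  - by move=> x; rewrite mem_filter => /andP[].
exists (TMul T0 (TMul (TGen (tlab e)) T1)) => V R p q.
apply: iff_trans (iff_sym (subhom_split_trunk s0 s1 sE eF R p q _ st)) => //; split.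
  by move=> [r /H0 h1 [r' h2 /H1 h3]]; exists r => //; exists r'.
by move=> [r h1 [r' h2 h3]]; exists r; [apply/H0|exists r' => //; apply/H1].
Qed.

Definition hom (V : Type) (R : V -> Sig -> V -> Prop) (p q : V) : Prop :=
  exists f : tV X -> V,
    [/\ forall e, R (f (tsrc e)) (tlab e) (f (ttgt e)), f (tst X) = p & f (ten X) = q].

Definition represents (T : term Sig) : Prop :=
  forall V R (p q : V), thom T R p q <-> hom R p q.

Lemma is_tree_term : is_tree X -> exists T, represents T.
Proof.
move=> hX; have [es hes] := is_tree_trunk hX; case: hX => hC [hA _].
have hr : reaches [set: tE X] (tst X).
  by move=> e _; have [w h] := hC (tst X) (tsrc e); exists w => // x _; rewrite inE.
have [|T hT] := subhom_term hA hr hes; first by move=> x _; rewrite inE.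
exists T => V R p q; apply: iff_trans (hT V R p q) _.
split=> -[f [h1 h2 h3]]; exists f; split=> // e.
by apply: h1; rewrite inE.
Qed.

End TermOfTree.

(** * Morphisms of trees and the unpruned operations *)

Section Homs.
Context (Sig : Type).
Implicit Types (X Y Z : tree Sig).

Definition edge_rel Y (u : tV Y) (a : Sig) (v : tV Y) : Prop :=
  exists e, [/\ tsrc e = u, tlab e = a & ttgt e = v].

Definition hle X Y : Prop := hom X (@edge_rel Y) (tst Y) (ten Y).

Lemma edge_relE Y (e : tE Y) : edge_rel (tsrc e) (tlab e) (ttgt e).
Proof. by exists e. Qed.

Lemma hle_morph X Y : hle X Y <-> exists fv fe, @is_morph Sig X Y fv fe.
Proof.
split=> [[fv [h1 h2 h3]]|[fv [fe [h1 [h2 [h3 [h4 h5]]]]]]].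
  have [fe hfe] := choice h1.
  by exists fv, fe; do ![split=> //]; move=> e; case: (hfe e).
by exists fv; split=> // e; rewrite -h1 -h2 -h3; apply: edge_relE.
Qed.

Lemma hom_map X Y (V : Type) (R : V -> Sig -> V -> Prop) (f : tV Y -> V) u v :
  (forall e, R (f (tsrc e)) (tlab e) (f (ttgt e))) ->
  hom X (@edge_rel Y) u v -> hom X R (f u) (f v).
Proof.
move=> hf [g [h1 <- <-]]; exists (f \o g); split=> // e /=.
by case: (h1 e) => d [<- <- <-].
Qed.

Lemma hom_hle X Y (V : Type) (R : V -> Sig -> V -> Prop) p q :
  hle X Y -> hom Y R p q -> hom X R p q.
Proof. by move=> h [f [hf <- <-]]; apply: hom_map h. Qed.

Lemma hle_refl X : hle X X.
Proof. by exists id; split=> // e; apply: edge_relE. Qed.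

(** The gluing is a pushout; with the always-true relation this glues arbitrary functions. *)
Lemma hom_tprod X Y (V : Type) (R : V -> Sig -> V -> Prop) (f1 : tV X -> V) (f2 : tV Y -> V) :
  (forall e, R (f1 (tsrc e)) (tlab e) (f1 (ttgt e))) ->
  (forall e, R (f2 (tsrc e)) (tlab e) (f2 (ttgt e))) -> f1 (ten X) = f2 (tst Y) ->
  exists f : tV (tprod X Y) -> V,
    [/\ forall e, R (f (tsrc e)) (tlab e) (f (ttgt e)),
        forall v, f (inl v) = f1 v & forall v, f (glue_map X v) = f2 v].
Proof.
move=> h1 h2 E.
pose f (v : glueV X Y) := match v with inl v => f1 v | inr v => f2 (val v) end.
have fg v : f (glue_map X v) = f2 v.
  rewrite /glue_map; case: insubP => [u _ <- //|/negPn/eqP -> /=]; exact: E.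
by exists f; split=> // -[e|e] //=; rewrite !fg.
Qed.

Lemma glue_map_st X Y : glue_map X (tst Y) = inl (ten X).
Proof. by rewrite /glue_map insubF // eqxx. Qed.

Lemma hom_prod X Y (V : Type) (R : V -> Sig -> V -> Prop) p q :
  hom (tprod X Y) R p q <-> exists2 r, hom X R p r & hom Y R r q.
Proof.
split.
  move=> [f [hf <- <-]]; exists (f (inl (ten X))).
    by exists (fun v => f (inl v)); split=> // e; apply: (hf (inl e)).
  exists (fun v => f (glue_map X v)); split=> [e||//]; first exact: (hf (inr e)).
  by rewrite glue_map_st.
move=> [r [f1 [h1 <- E1]] [f2 [h2 E2 <-]]].
have [|f [h3 h4 h5]] := @hom_tprod X Y V R f1 f2 h1 h2; first by rewrite E1.
by exists f; split=> //=.
Qed.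

Lemma hom_plus X (V : Type) (R : V -> Sig -> V -> Prop) p q :
  hom (tplus0 X) R p q <-> p = q /\ exists r, hom X R p r.
Proof.
split; first by move=> [f [hf <- <-]]; split=> //; exists (f (ten X)), f.
by move=> [<- [r [f [hf <- _]]]]; exists f.
Qed.

Lemma hom_star X (V : Type) (R : V -> Sig -> V -> Prop) p q :
  hom (tstar0 X) R p q <-> p = q /\ exists r, hom X R r q.
Proof.
split; first by move=> [f [hf <- <-]]; split=> //; exists (f (tst X)), f.
by move=> [<- [r [f [hf _ <-]]]]; exists f.
Qed.

Lemma hom_base_tree a (V : Type) (R : V -> Sig -> V -> Prop) p q :
  hom (base_tree a) R p q <-> R p a q.
Proof.
split; first by move=> [f [hf <- <-]]; apply: (hf tt).
by move=> h; exists (fun b : bool => if b then q else p).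
Qed.

(** The unit of the unpruned product; being trivial it lies outside [TS] and plays the adjoined
    identity. *)
Definition point_tree : tree Sig :=
  @Tree Sig unit void (fun e => match e with end) (fun e => match e with end)
    (fun e => match e with end) tt tt.

Lemma hom_point_tree (V : Type) (R : V -> Sig -> V -> Prop) p q :
  hom point_tree R p q <-> p = q.
Proof. by split=> [[f [_ <- <-]]|->] //; exists (fun _ => q); split=> // -[]. Qed.

Lemma uwalk_map X Y (fv : tV X -> tV Y) (fe : tE X -> tE Y) u w v :
  (forall e, tsrc (fe e) = fv (tsrc e)) -> (forall e, ttgt (fe e) = fv (ttgt e)) ->
  uwalk u w v -> uwalk (fv u) [seq (fe s.1, s.2) | s <- w] (fv v).
Proof.
move=> hs ht; elim: w u => [|[e b] w IH] u /=; first by move=> ->.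
by case=> <- /IH; rewrite hs ht; case: (b).
Qed.

Lemma uwalk_sym X (u : tV X) w v : uwalk u w v -> exists w', uwalk v w' u.
Proof.
elim: w u => [|[e b] w IH] u /=; first by move=> ->; exists [::].
case=> <- /IH [w' h]; exists (w' ++ [:: (e, ~~ b)]); apply/uwalk_cat.
by eexists; [exact: h|rewrite /=; case: (b)].
Qed.

Lemma connected_from X r : (forall v : tV X, exists w, uwalk r w v) -> connected X.
Proof.
move=> h u v; have [w1 h1] := h u; have [w2 h2] := h v.
by have [w3 h3] := uwalk_sym h1; exists (w3 ++ w2); apply/uwalk_cat; exists r.
Qed.

(** A walk avoiding [e] keeps its side, so a closed walk that starts with [e] must use [e] again. *)
Lemma side_acyclic X : (forall e, exists side : tV X -> bool,
    [/\ side (tsrc e) = false, side (ttgt e) &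
        forall d, d != e -> side (tsrc d) = side (ttgt d)]) -> acyclic X.
Proof.
move=> h u [//|[e b] w] hw /= /andP[he _]; have [side [s0 s1 sE]] := h e.
have stay x y z : e \notin map fst x -> uwalk y x z -> side y = side z.
  elim: x y => [|[d c] x IH] y /=; first by move=> _ ->.
  rewrite inE eq_sym negb_or => /andP[de hx] [<- /(IH _ hx) <-].
  by case: c; rewrite (sE d de).
case: hw => /= <- /(stay _ _ _ he).
by case: (b); rewrite s0 s1.
Qed.

Lemma is_tree_prod X Y : is_tree X -> is_tree Y -> is_tree (tprod X Y).
Proof.
move=> [cX [aX [wX [dX tX]]]] [cY [aY [wY [dY tY]]]].
have inX u w v : uwalk u w v ->
    uwalk (inl u : tV (tprod X Y)) [seq (inl s.1 : tE (tprod X Y), s.2) | s <- w] (inl v).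
  exact: (@uwalk_map X (tprod X Y) inl inl).
have inY u w v : uwalk u w v ->
    uwalk (glue_map X u : tV (tprod X Y)) [seq (inr s.1 : tE (tprod X Y), s.2) | s <- w]
      (glue_map X v).
  exact: (@uwalk_map Y (tprod X Y) (@glue_map Sig X Y) inr).
split; [|split].
- apply: (@connected_from (tprod X Y) (inl (ten X))) => -[v|v].
    by have [w /inX h] := cX (ten X) v; eexists; exact: h.
  have -> : inr v = glue_map X (val v) by rewrite /glue_map valK.
  have [w /inY] := cY (tst Y) (val v).
  by rewrite glue_map_st => h; eexists; exact: h.
- apply: side_acyclic => -[e|e].
    have [side [s0 s1 sE]] := acyclic_side e aX.
    (* The side function of an edge of one factor extends to the product by a constant on the
       other. *)
    have [//|//|//|f [h1 h2 h3]] :=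
      @hom_tprod X Y bool (fun _ _ _ => True) side (fun _ => side (ten X)).
    exists f; split=> /=; rewrite ?h2 // => -[d|d] hd /=; rewrite ?h2 ?h3 //.
    by apply: sE; apply: contra hd => /eqP ->.
  have [side [s0 s1 sE]] := acyclic_side e aY.
  have [//|//|//|f [h1 h2 h3]] :=
      @hom_tprod X Y bool (fun _ _ _ => True) (fun _ => side (tst Y)) side.
  exists f; split=> /=; rewrite ?h3 // => -[d|d] hd /=; rewrite ?h2 ?h3 //.
  by apply: sE; apply: contra hd => /eqP ->.
- exists ([seq (inl s.1 : tE (tprod X Y), s.2) | s <- wX] ++
          [seq (inr s.1 : tE (tprod X Y), s.2) | s <- wY]); split.
    rewrite all_cat !all_map; apply/andP; split.
      by apply: sub_all dX.
    by apply: sub_all dY.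
  apply/uwalk_cat; exists (inl (ten X)); first exact: inX.
  by rewrite -glue_map_st; apply: inY.
Qed.

Lemma is_tree_regraph X (s t : tV X) es : darc s es t -> connected X -> acyclic X ->
  is_tree (@Tree Sig (tV X) (tE X) (@tsrc Sig X) (@ttgt Sig X) (@tlab Sig X) s t).
Proof.
set Y := Tree _ _ _ _ _; move=> hes hC hA.
have to u w v : @uwalk Sig X u w v -> @uwalk Sig Y u w v.
  by move=> h; have := @uwalk_map X Y id id u w v (fun _ => erefl) (fun _ => erefl) h;
    rewrite map_id_in //; case.
have from u w v : @uwalk Sig Y u w v -> @uwalk Sig X u w v.
  by move=> h; have := @uwalk_map Y X id id u w v (fun _ => erefl) (fun _ => erefl) h;
    rewrite map_id_in //; case.
split; [|split].
- by move=> u v; have [w /to h] := hC u v; exists w.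
- by move=> u w /from; apply: hA.
- exists [seq (e, true) | e <- es]; split; last exact: to.
  by rewrite all_map; apply/allP.
Qed.

Lemma is_tree_plus X : is_tree X -> is_tree (tplus0 X).
Proof. by case=> hC [hA _]; apply: (@is_tree_regraph X (tst X) (tst X) [::]). Qed.

Lemma is_tree_star X : is_tree X -> is_tree (tstar0 X).
Proof. by case=> hC [hA _]; apply: (@is_tree_regraph X (ten X) (ten X) [::]). Qed.

Lemma is_tree_base (a : Sig) : is_tree (base_tree a).
Proof.
split; [|split].
- apply: (@connected_from (base_tree a) false) => -[].
    by exists [:: (tt, true)].
  by exists [::].
- by apply: side_acyclic => -[]; exists id; split=> // -[].
- by exists [:: (tt, true)].
Qed.

Lemma is_tree_point : is_tree point_tree.
Proof.
split; [|split].
- by move=> [] []; exists [::].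
- by apply: side_acyclic => -[].
- by exists [::].
Qed.

Lemma nontrivial_edge X : is_tree X -> nontrivial X <-> inhabited (tE X).
Proof.
case=> hC [hA _]; split.
  move=> hn; apply: contrapT => hE; apply: hn; apply/eqP/fintype1P.
  exists (tst X) => v; apply/esym/eqP.
  have [[|s w] hw] := hC v (tst X); first by rewrite hw.
  by case: hE; split; exact: s.1.
move=> [e] /eqP/fintype1P [x hx].
suff : [:: (e, true)] = [::] by [].
apply: (hA (tsrc e)) => //=; split=> //.
by rewrite [LHS]hx [RHS]hx.
Qed.

End Homs.

(** * Retractions and pruned cores *)

Lemma iter_idempotent (T : finType) (f : T -> T) :
  exists2 n, 0 < n & forall x, iter n f (iter n f x) = iter n f x.
Proof.
pose F (k : 'I_(#|{ffun T -> T}|.+1)) : {ffun T -> T} := [ffun x => iter k f x].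
have /injectivePn [i [j ij E]] : ~~ injectiveb F.
  by apply/negP => /injectiveP/leq_card; rewrite card_ord ltnn.
wlog lij : i j ij E / i < j.
  move=> h; have [|l|Eij] := ltngtP i j; first exact: h.
    by apply: (h j i) => //; rewrite eq_sym.
  by case/eqP: ij; apply: val_inj.
have per m x : i <= m -> iter (m + (j - i)) f x = iter m f x.
  move=> im; have /ffunP/(_ x) := E; rewrite !ffunE => Ex.
  by rewrite -(subnK im) -addnA subnKC ?(ltnW lij) // !iterD Ex.
have pers m k x : i <= m -> iter (m + k * (j - i)) f x = iter m f x.
  move=> im; elim: k => [|k IH]; first by rewrite addn0.
  by rewrite mulSn addnCA addnC per ?IH // (leq_trans im) ?leq_addr.
have d0 : 0 < j - i by rewrite subn_gt0.
(* A multiple of the period [j - i] that is at least [i]; the successor keeps it positive when [i]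
   is zero. *)
exists (i.+1 * (j - i)); first by rewrite muln_gt0.
move=> x; rewrite -iterD pers //.
by apply: leq_trans (leqnSn i) _; apply: leq_pmulr.
Qed.

Section Pruning.
Context (Sig : Type).
Implicit Types (X Y Z W : tree Sig).

Lemma is_morph_comp X Y Z fv fe gv ge :
  @is_morph Sig X Y fv fe -> @is_morph Sig Y Z gv ge -> is_morph (gv \o fv) (ge \o fe).
Proof.
move=> [a1 [a2 [a3 [a4 a5]]]] [b1 [b2 [b3 [b4 b5]]]].
by split; [|split; [|split; [|split]]] => [e|e|e||] /=;
  rewrite ?b1 ?a1 ?b2 ?a2 ?b3 ?a3 ?a4 ?b4 ?a5 ?b5.
Qed.

Lemma is_morph_id X : @is_morph Sig X X id id.
Proof. by []. Qed.

Lemma is_morph_iter X fv fe n :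
  @is_morph Sig X X fv fe -> is_morph (iter n fv) (iter n fe).
Proof.
move=> h; elim: n => [|n IH]; first exact: is_morph_id.
exact: is_morph_comp IH h.
Qed.

(** Some positive power of the endomorphism is a retraction, hence the identity. Vertices and edges
    are put in one sum type so that a single exponent serves both. *)
Lemma pruned_endo_inj X fv fe : pruned X -> @is_morph Sig X X fv fe ->
  injective fv /\ injective fe.
Proof.
move=> hX hf.
have [n n0 hn] := iter_idempotent (fun z : tV X + tE X =>
  match z with inl v => inl (fv v) | inr e => inr (fe e) end).
have itl k v : iter k (fun z : tV X + tE X =>
  match z with inl v => inl (fv v) | inr e => inr (fe e) end) (inl v) = inl (iter k fv v).
  by elim: k => //= k ->.
have itr k e : iter k (fun z : tV X + tE X =>
  match z with inl v => inl (fv v) | inr e => inr (fe e) end) (inr e) = inr (iter k fe e).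
  by elim: k => //= k ->.
have [|hv he] := hX (iter n fv) (iter n fe).
  split; first exact: is_morph_iter.
  split=> [v|e]; first by have := hn (inl v); rewrite !itl => -[].
  by have := hn (inr e); rewrite !itr => -[].
case: n n0 hv he {hn} => // n _ hv he.
split=> [u v|u v] E; first by rewrite -(hv u) -(hv v) !iterSr E.
by rewrite -(he u) -(he v) !iterSr E.
Qed.

Lemma pruned_hle_iso X Y : pruned X -> pruned Y -> hle X Y -> hle Y X -> iso X Y.
Proof.
move=> pX pY /hle_morph [fv [fe hf]] /hle_morph [gv [ge hg]].
have [i1 i2] := pruned_endo_inj pX (is_morph_comp hf hg).
have [i3 i4] := pruned_endo_inj pY (is_morph_comp hg hf).
exists fv, fe; split=> //; split; apply: inj_card_bij.
- exact: inj_compr i1.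
- exact: leq_card (inj_compr i3).
- exact: inj_compr i2.
- exact: leq_card (inj_compr i4).
Qed.

Lemma iso_sym X Y : iso X Y -> iso Y X.
Proof.
move=> [fv [fe [[a1 [a2 [a3 [a4 a5]]]] [[gv k1 k2] [ge k3 k4]]]]].
exists gv, ge; split; last by split; [exists fv|exists fe].
split; [|split; [|split; [|split]]].
- by move=> e; rewrite -[e in RHS]k4 a1 k1.
- by move=> e; rewrite -[e in RHS]k4 a2 k1.
- by move=> e; rewrite -[e in RHS]k4 a3.
- by rewrite -a4 k1.
- by rewrite -a5 k1.
Qed.

Lemma iso_trans Y X Z : iso X Y -> iso Y Z -> iso X Z.
Proof.
move=> [fv [fe [hf [bv be]]]] [gv [ge [hg [cv ce]]]].
exists (gv \o fv), (ge \o fe); split; first exact: is_morph_comp hg.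
by split; apply: bij_comp.
Qed.

Lemma iso_hle X Y : iso X Y -> hle X Y.
Proof. by case=> fv [fe [h _]]; apply/hle_morph; exists fv, fe. Qed.

Definition split_retract W X : Prop :=
  exists iv ie rv re, [/\ @is_morph Sig W X iv ie, @is_morph Sig X W rv re,
    cancel iv rv & cancel ie re].

Lemma split_retract_trans Y X Z :
  split_retract X Y -> split_retract Y Z -> split_retract X Z.
Proof.
move=> [iv [ie [rv [re [h1 h2 h3 h4]]]]] [iv' [ie' [rv' [re' [h1' h2' h3' h4']]]]].
exists (iv' \o iv), (ie' \o ie), (rv \o rv'), (re \o re').
by split; [exact: is_morph_comp h1'|exact: is_morph_comp h2' h2|exact: can_comp|exact: can_comp].
Qed.

Lemma split_retract_hle W X : split_retract W X -> hle W X /\ hle X W.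
Proof.
move=> [iv [ie [rv [re [h1 h2 _ _]]]]].
by split; apply/hle_morph; [exists iv, ie|exists rv, re].
Qed.

Lemma retract_split W X : is_retract_of W X -> split_retract W X.
Proof.
move=> [rv [re [iv [ie [[hr [idv ide]] [hi [jv [je [imv ime]]]]]]]]].
have /choice [kv hkv] : forall v, exists w, iv w = rv v by move=> v; apply/imv; exists v.
have /choice [ke hke] : forall e, exists d, ie d = re e by move=> e; apply/ime; exists e.
exists iv, ie, kv, ke; split=> //; last 2 first.
- by move=> w; apply: jv; rewrite hkv; have /imv [u <-] : exists w', iv w' = iv w by exists w.
- by move=> w; apply: je; rewrite hke; have /ime [u <-] : exists w', ie w' = ie w by exists w.
case: hr => a1 [a2 [a3 [a4 a5]]]; case: hi => b1 [b2 [b3 [b4 b5]]].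
split; [|split; [|split; [|split]]].
- by move=> e; apply: jv; rewrite -b1 hke a1 hkv.
- by move=> e; apply: jv; rewrite -b2 hke a2 hkv.
- by move=> e; rewrite -b3 hke a3.
- by apply: jv; rewrite hkv a4 b4.
- by apply: jv; rewrite hkv a5 b5.
Qed.

Lemma split_retract_is_tree W X : split_retract W X -> is_tree X -> is_tree W.
Proof.
move=> [iv [ie [rv [re [[a1 [a2 _]] [b1 [b2 [_ [b4 b5]]]] kv ke]]]]] [hC [hA [w [dw hw]]]].
split; [|split].
- move=> u v; have [x /(uwalk_map b1 b2)] := hC (iv u) (iv v).
  by rewrite !kv => h; eexists; exact: h.
- move=> u x /(uwalk_map a1 a2) h hu.
  have : [seq (ie s.1, s.2) | s <- x] = [::].
    apply: hA h _; rewrite -map_comp.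
    by rewrite (map_comp ie fst) map_inj_uniq //; apply: can_inj ke.
  by case: x {h hu}.
- exists [seq (re s.1, s.2) | s <- w]; rewrite -b4 -b5; split; last exact: uwalk_map.
  by rewrite all_map.
Qed.

Section Image.
Context X fv fe (hr : @retraction Sig X fv fe).

Lemma image_src (e : {e | fe e == e}) : fv (tsrc (val e)) == tsrc (val e).
Proof. by case: hr => -[<- _] _; rewrite (eqP (valP e)). Qed.

Lemma image_tgt (e : {e | fe e == e}) : fv (ttgt (val e)) == ttgt (val e).
Proof. by case: hr => -[_ [<- _]] _; rewrite (eqP (valP e)). Qed.

Lemma image_st : fv (tst X) == tst X.
Proof. by case: hr => -[_ [_ [_ [-> _]]]]. Qed.

Lemma image_en : fv (ten X) == ten X.
Proof. by case: hr => -[_ [_ [_ [_ ->]]]]. Qed.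

Definition image_tree : tree Sig :=
  @Tree Sig {v | fv v == v} {e | fe e == e}
    (fun e => exist (fun v => fv v == v) (tsrc (val e)) (image_src e))
    (fun e => exist (fun v => fv v == v) (ttgt (val e)) (image_tgt e))
    (fun e => tlab (val e))
    (exist (fun v => fv v == v) (tst X) image_st)
    (exist (fun v => fv v == v) (ten X) image_en).

Lemma image_tree_retract : split_retract image_tree X.
Proof.
case: (hr) => -[a1 [a2 [a3 [a4 a5]]]] [iv ie].
have sv v : fv (fv v) == fv v by rewrite iv.
have se e : fe (fe e) == fe e by rewrite ie.
exists val, val, (fun v => exist (fun v => fv v == v) (fv v) (sv v)),
  (fun e => exist (fun d => fe d == d) (fe e) (se e)); split.
- by [].
- split; [|split; [|split; [|split]]] => [e|e|e||]; try apply: val_inj; rewrite /= ?SubK //.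
- by move=> v; apply: val_inj; rewrite SubK (eqP (valP v)).
- by move=> v; apply: val_inj; rewrite SubK (eqP (valP v)).
Qed.

End Image.

(** A non-identity retraction has a strictly smaller image, so descent on the number of vertices
    plus edges terminates. *)
Lemma pruned_core X : exists2 W, pruned W & split_retract W X.
Proof.
have [n] := ubnP (#|tV X| + #|tE X|); elim: n X => // n IH X; rewrite ltnS => hn.
have [pX|/existsNP [fv /existsNP [fe /not_implyP [hr hne]]]] := pselect (pruned X).
  by exists X => //; exists id, id, id, id.
have [|W pW hW] := IH (image_tree hr); last first.
  by exists W => //; apply: split_retract_trans hW (image_tree_retract hr).
apply: leq_trans hn; rewrite /= !card_sig.
have le1 : #|[pred v | fv v == v]| <= #|tV X| by apply: max_card.
have le2 : #|[pred e | fe e == e]| <= #|tE X| by apply: max_card.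
rewrite ltn_neqAle leq_add // andbT; apply/negP => /eqP E.
have [E1 E2] : #|[pred v | fv v == v]| = #|tV X| /\ #|[pred e | fe e == e]| = #|tE X|.
  split; apply/eqP; rewrite eqn_leq ?le1 ?le2 /=.
    by rewrite -(leq_add2r #|[pred e | fe e == e]|) E leq_add2l.
  by rewrite -(leq_add2l #|[pred v | fv v == v]|) E leq_add2r.
apply: hne; split=> x.
  have /subset_cardP/(_ (subset_predT _))/(_ x) : #|[pred v | fv v == v]| = #|tV X| by [].
  by rewrite !inE => /eqP.
have /subset_cardP/(_ (subset_predT _))/(_ x) : #|[pred v | fe v == v]| = #|tE X| by [].
by rewrite !inE => /eqP.
Qed.

End Pruning.

(** * Isomorphism types of pruned trees *)

Section TreeTypes.
Context (Sig : Type).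
Implicit Types (X Y Z W : tree Sig) (p q : TS Sig).

Lemma TS_pruned_repr p : {X : tree Sig | [/\ is_tree X, pruned X, nontrivial X & sval p = iso X]}.
Proof. by apply: cid; case: (proj2_sig p : isoclass (sval p)) => X [h1 [h2 [h3 h4]]]; exists X. Qed.

Definition pruned_repr p : tree Sig := sval (TS_pruned_repr p).

Lemma pruned_repr_tree p : is_tree (pruned_repr p).
Proof. by rewrite /pruned_repr; case: TS_pruned_repr => X []. Qed.

Lemma pruned_repr_pruned p : pruned (pruned_repr p).
Proof. by rewrite /pruned_repr; case: TS_pruned_repr => X []. Qed.

Lemma pruned_repr_edge p : inhabited (tE (pruned_repr p)).
Proof. by have [hX _ hn _] := proj2_sig (TS_pruned_repr p); apply/(nontrivial_edge hX). Qed.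

Lemma sval_pruned_repr p : sval p = iso (pruned_repr p).
Proof. by rewrite /pruned_repr; case: TS_pruned_repr => X []. Qed.

Definition heq X Y : Prop := hle X Y /\ hle Y X.

Lemma heq_hom X Y (V : Type) (R : V -> Sig -> V -> Prop) a b :
  heq X Y -> hom X R a b <-> hom Y R a b.
Proof. by case=> h1 h2; split; apply: hom_hle. Qed.

(** Each tree is tested in its own edge relation, where the identity map is a morphism. *)
Lemma hom_heq X Y :
  (forall (V : Type) (R : V -> Sig -> V -> Prop) a b, hom X R a b <-> hom Y R a b) -> heq X Y.
Proof. by move=> h; split; apply/h; apply: hle_refl. Qed.

Lemma heq_sym X Y : heq X Y -> heq Y X. Proof. by case. Qed.

Lemma heq_trans Y X Z : heq X Y -> heq Y Z -> heq X Z.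
Proof. by move=> [a b] [c d]; split; [apply: hom_hle a c|apply: hom_hle d b]. Qed.

Lemma mem_heq p X : sval p X -> heq (pruned_repr p) X.
Proof. by rewrite sval_pruned_repr => h; split; apply: iso_hle => //; apply: iso_sym. Qed.

Lemma heq_mem p X : pruned X -> heq (pruned_repr p) X -> sval p X.
Proof.
move=> hX [h1 h2]; rewrite sval_pruned_repr; apply: pruned_hle_iso => //.
exact: pruned_repr_pruned.
Qed.

Lemma TS_eq p q : heq (pruned_repr p) (pruned_repr q) -> p = q.
Proof.
move=> [h1 h2]; have hpq : iso (pruned_repr p) (pruned_repr q).
  by apply: pruned_hle_iso => //; apply: pruned_repr_pruned.
have : sval p = sval q.
  rewrite !sval_pruned_repr; apply: funext => X; apply: propext.
  by split; apply: iso_trans => //; apply: iso_sym.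
by case: p q {h1 h2 hpq} => [P hP] [Q hQ] /= E; subst Q; congr exist; apply: Prop_irrelevance.
Qed.

Lemma TS_ext p q : (forall (V : Type) (R : V -> Sig -> V -> Prop) a b,
  hom (pruned_repr p) R a b <-> hom (pruned_repr q) R a b) -> p = q.
Proof. by move=> h; apply/TS_eq/hom_heq. Qed.

Lemma TS_of_tree X : is_tree X -> inhabited (tE X) -> exists p, heq (pruned_repr p) X.
Proof.
move=> hX [e]; have [W pW hW] := pruned_core X.
have tW := split_retract_is_tree hW hX.
have nW : nontrivial W.
  by apply/nontrivial_edge => //; case: hW => _ [_ [_ [re _]]]; split; exact: re e.
have hp : isoclass (iso W) by exists W.
exists (exist _ (iso W) hp); apply: (@heq_trans W); last exact: split_retract_hle.
by apply/mem_heq; exists id, id; split=> //; split; exists id.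
Qed.

End TreeTypes.

(** * Morphisms between products with a common factor *)

Section GluePoint.
Context (Sig : Type).
Implicit Types (X Y P : tree Sig).

Lemma hom_darc X Y u v es : darc (tst X) es (ten X) -> hom X (@edge_rel _ Y) u v ->
  exists2 es', darc u es' v & size es' = size es.
Proof.
move=> hes [f [/choice [fe hf] <- <-]]; exists (map fe es); last by rewrite size_map.
have := @uwalk_map _ X Y f fe _ _ _ _ _ hes; rewrite /darc -!map_comp.
by apply=> e; case: (hf e).
Qed.

Lemma hom_left X Y : hom X (@edge_rel _ (tprod X Y)) (inl (tst X)) (inl (ten X)).
Proof. by exists inl; split=> // e; apply: (@edge_relE _ (tprod X Y) (inl e)). Qed.

Lemma hom_right X Y :
  hom Y (@edge_rel _ (tprod X Y)) (inl (ten X)) (glue_map X (ten Y)).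
Proof.
exists (@glue_map _ X Y); split=> //; last exact: glue_map_st.
by move=> e; apply: (@edge_relE _ (tprod X Y) (inr e)).
Qed.

(* A directed walk of a tree is determined by its ends, so a morphism between
   products with a common factor must match the two gluing vertices. *)
Lemma hle_prod_glue X Y X' Y' : is_tree X -> is_tree Y -> is_tree X' -> is_tree Y' ->
  X = X' \/ Y = Y' -> hle (tprod X Y) (tprod X' Y') ->
  let T := tprod X' Y' in
  hom X (@edge_rel _ T) (tst T) (inl (ten X')) /\
  hom Y (@edge_rel _ T) (inl (ten X')) (ten T).
Proof.
move=> tX tY tX' tY' E /hom_prod [c h1 h2] T.
have [_ [aT _]] := is_tree_prod tX' tY'.
have [e1 d1] := is_tree_trunk tX; have [e2 d2] := is_tree_trunk tY.
have [a k1 sa] := hom_darc d1 h1; have [b k2 sb] := hom_darc d2 h2.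
have [e1' d1'] := is_tree_trunk tX'; have [e2' d2'] := is_tree_trunk tY'.
have [a' k1' sa'] := hom_darc d1' (hom_left X' Y').
have [b' k2' sb'] := hom_darc d2' (hom_right X' Y').
suff <- : c = inl (ten X') by [].
apply: (darc_mid aT k1 k2 k1' k2'); rewrite sa sb sa' sb'.
case: E => E; [left; subst X'; have [_ [aX _]] := tX|right; subst Y'; have [_ [aY _]] := tY].
  by rewrite (darc_uniq aX d1 d1').
by rewrite (darc_uniq aY d2 d2').
Qed.

(** The morphism respects the gluing vertices, so it splits into a map on [X] and a map on [P]; both
    survive moving the end vertex of [P]. *)
Lemma hle_prod_plus X Y P : is_tree X -> is_tree Y -> is_tree P ->
  hle (tprod X P) (tprod Y P) -> hle (tprod X (tplus0 P)) (tprod Y (tplus0 P)).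
Proof.
move=> tX tY tP h; have [|h1 h2] := hle_prod_glue tX tP tY tP _ h; first by right.
have /hom_prod [c [f1 [k1 e1 e2]] /hom_plus [ec [d [f2 [k2 e3 e4]]]]] :=
  hle_refl (tprod Y (tplus0 P)).
have [|f [kf fl fr]] := @hom_tprod _ Y P _ _ f1 f2 k1 k2; first by rewrite e2 e3.
apply/hom_prod; exists c; first by move: (hom_map kf h1); rewrite /= !fl e1 e2.
apply/hom_plus; split=> //; exists (f (ten (tprod Y P))).
by move: (hom_map kf h2); rewrite fl e2.
Qed.

Lemma hle_star_prod X Y P : is_tree X -> is_tree Y -> is_tree P ->
  hle (tprod P X) (tprod P Y) -> hle (tprod (tstar0 P) X) (tprod (tstar0 P) Y).
Proof.
move=> tX tY tP h; have [|h1 h2] := hle_prod_glue tP tX tP tY _ h; first by left.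
have /hom_prod [c /hom_star [ec [d [f1 [k1 e1 e2]]]] [f2 [k2 e3 e4]]] :=
  hle_refl (tprod (tstar0 P) Y).
have [|f [kf fl fr]] := @hom_tprod _ P Y _ _ f1 f2 k1 k2; first by rewrite e2 e3.
apply/hom_prod; exists c; last by move: (hom_map kf h2); rewrite /= fl fr e2 e4.
apply/hom_star; split=> //; exists (f (tst (tprod P Y))).
by move: (hom_map kf h1); rewrite fl e2.
Qed.

(** Uniqueness of directed walks makes the trunk of [X] twice as long as itself, hence empty. *)
Lemma hle_square_loop X (V : Type) (R : V -> Sig -> V -> Prop) p q :
  is_tree X -> hle (tprod X X) X -> hom X R p q -> p = q.
Proof.
move=> tX /hom_prod [c h1 h2] [f [_ <- <-]].
have [_ [aX _]] := tX; have [es d] := is_tree_trunk tX.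
have [a k1 sa] := hom_darc d h1; have [b k2 sb] := hom_darc d h2.
have k : darc (tst X) (a ++ b) (ten X) by apply/darc_cat; exists c.
have := congr1 size (darc_uniq aX d k); rewrite size_cat sa sb => /eqP.
rewrite -{1}[size es]addn0 eqn_add2l eq_sym size_eq0 => /eqP E.
by move: d; rewrite E /darc /= => ->.
Qed.

End GluePoint.

(** * The adequate semigroup of tree types *)

Section TreeAlgebra.
Context (Sig : Type).
Implicit Types (p q r : TS Sig) (x y : option (TS Sig)).

Lemma TS_mul_ex p q : exists r, heq (pruned_repr r) (tprod (pruned_repr p) (pruned_repr q)).
Proof.
apply: TS_of_tree; first by apply: is_tree_prod; apply: pruned_repr_tree.
by case: (pruned_repr_edge p) => e; split; exact: inl e.
Qed.

Lemma TS_plus_ex p : exists r, heq (pruned_repr r) (tplus0 (pruned_repr p)).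
Proof.
by apply: TS_of_tree; [apply: is_tree_plus; apply: pruned_repr_tree|apply: pruned_repr_edge].
Qed.

Lemma TS_star_ex p : exists r, heq (pruned_repr r) (tstar0 (pruned_repr p)).
Proof.
by apply: TS_of_tree; [apply: is_tree_star; apply: pruned_repr_tree|apply: pruned_repr_edge].
Qed.

Definition TS_mul p q : TS Sig := sval (cid (TS_mul_ex p q)).
Definition TS_plus p : TS Sig := sval (cid (TS_plus_ex p)).
Definition TS_star p : TS Sig := sval (cid (TS_star_ex p)).

Lemma TS_mulP p q : heq (pruned_repr (TS_mul p q)) (tprod (pruned_repr p) (pruned_repr q)).
Proof. exact: (svalP (cid (TS_mul_ex p q))). Qed.

Section HomOps.
Context (V : Type) (R : V -> Sig -> V -> Prop).

Lemma hom_TS_mul p q a b : hom (pruned_repr (TS_mul p q)) R a b <->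
  exists2 c, hom (pruned_repr p) R a c & hom (pruned_repr q) R c b.
Proof. by apply: iff_trans (heq_hom _ _ _ (TS_mulP p q)) _; apply: hom_prod. Qed.

Lemma hom_TS_plus p a b : hom (pruned_repr (TS_plus p)) R a b <->
  a = b /\ exists c, hom (pruned_repr p) R a c.
Proof.
by apply: iff_trans (heq_hom _ _ _ (svalP (cid (TS_plus_ex p)))) _; apply: hom_plus.
Qed.

Lemma hom_TS_star p a b : hom (pruned_repr (TS_star p)) R a b <->
  a = b /\ exists c, hom (pruned_repr p) R c b.
Proof.
by apply: iff_trans (heq_hom _ _ _ (svalP (cid (TS_star_ex p)))) _; apply: hom_star.
Qed.

End HomOps.

Lemma TS_pruned_ops : pruned_ops TS_mul TS_plus TS_star.
Proof.
have core r W X : pruned_retract W X ->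
    (forall (V : Type) (R : V -> Sig -> V -> Prop) a b,
      hom (pruned_repr r) R a b <-> hom X R a b) ->
    sval r W.
  move=> [hW pW] h; apply: heq_mem => //; apply: heq_trans (hom_heq h) _.
  exact/heq_sym/split_retract_hle/retract_split.
split; [|split].
- move=> p q X Y W hX hY hW; apply: (core _ _ _ hW) => V R a b.
  apply: iff_trans (hom_TS_mul R p q a b) _; apply: iff_trans (iff_sym (hom_prod _ _ _ _ _)).
  by split=> -[c /(heq_hom _ _ _ (mem_heq hX)) h1 /(heq_hom _ _ _ (mem_heq hY)) h2]; exists c.
- move=> p X W hX hW; apply: (core _ _ _ hW) => V R a b.
  apply: iff_trans (hom_TS_plus R p a b) _; apply: iff_trans (iff_sym (hom_plus _ _ _ _)).
  by split=> -[E [c /(heq_hom _ _ _ (mem_heq hX)) h1]]; split=> //; exists c.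
- move=> p X W hX hW; apply: (core _ _ _ hW) => V R a b.
  apply: iff_trans (hom_TS_star R p a b) _; apply: iff_trans (iff_sym (hom_star _ _ _ _)).
  by split=> -[E [c /(heq_hom _ _ _ (mem_heq hX)) h1]]; split=> //; exists c.
Qed.

Lemma TS_base (a : Sig) : exists p : TS Sig, sval p (base_tree a).
Proof.
have [|p hp] := TS_of_tree (is_tree_base a); first exact: (inhabits tt).
exists p; apply: heq_mem => // fv fe [[_ [_ [_ [h1 h2]]]] _].
by split=> [[]|[]] //; case: (fe tt).
Qed.

Lemma TS_mulA p q r : TS_mul p (TS_mul q r) = TS_mul (TS_mul p q) r.
Proof.
apply: TS_ext => V R a b; split.
  case/hom_TS_mul => c h1 /hom_TS_mul [d h2 h3]; apply/hom_TS_mul; exists d => //.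
  by apply/hom_TS_mul; exists c.
case/hom_TS_mul => d /hom_TS_mul [c h1 h2] h3; apply/hom_TS_mul; exists c => //.
by apply/hom_TS_mul; exists d.
Qed.

Lemma TS_idem_loop p (V : Type) (R : V -> Sig -> V -> Prop) a b :
  idem TS_mul p -> hom (pruned_repr p) R a b -> a = b.
Proof.
move=> hp; apply: hle_square_loop; first exact: pruned_repr_tree.
by have [_] := TS_mulP p p; rewrite hp.
Qed.

Lemma TS_idemC p q : idem TS_mul p -> idem TS_mul q -> TS_mul p q = TS_mul q p.
Proof.
move=> hp hq; apply: TS_ext => V R a b.
split=> /hom_TS_mul [c h1 h2]; apply/hom_TS_mul.
  have E1 := TS_idem_loop hp h1; have E2 := TS_idem_loop hq h2; subst c b; by exists a.
have E1 := TS_idem_loop hq h1; have E2 := TS_idem_loop hp h2; subst c b; by exists a.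
Qed.

Lemma TS_plus_idem p : idem TS_mul (TS_plus p).
Proof.
apply: TS_ext => V R a b; split; first by case/hom_TS_mul => c /hom_TS_plus [-> _].
by move=> /[dup] h /hom_TS_plus [E _]; subst b; apply/hom_TS_mul; exists a.
Qed.

Lemma TS_star_idem p : idem TS_mul (TS_star p).
Proof.
apply: TS_ext => V R a b; split; first by case/hom_TS_mul => c /hom_TS_star [-> _].
by move=> /[dup] h /hom_TS_star [E _]; subst b; apply/hom_TS_mul; exists a.
Qed.

Lemma TS_plusK p : TS_mul (TS_plus p) p = p.
Proof.
apply: TS_ext => V R a b; split; first by case/hom_TS_mul => c /hom_TS_plus [-> _].
by move=> h; apply/hom_TS_mul; exists a => //; apply/hom_TS_plus; split=> //; exists b.
Qed.

Lemma TS_starK p : TS_mul p (TS_star p) = p.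
Proof.
apply: TS_ext => V R a b; split; first by case/hom_TS_mul => c h /hom_TS_star [<- _].
by move=> h; apply/hom_TS_mul; exists b => //; apply/hom_TS_star; split=> //; exists a.
Qed.

Definition orepr x : tree Sig := if x is Some p then pruned_repr p else point_tree Sig.

Lemma orepr_tree x : is_tree (orepr x).
Proof. by case: x => [p|]; [apply: pruned_repr_tree|apply: is_tree_point]. Qed.

Lemma heq_lact x p : heq (pruned_repr (lact TS_mul x p)) (tprod (orepr x) (pruned_repr p)).
Proof.
case: x => [q|] /=; first exact: TS_mulP.
apply: hom_heq => V R a b; apply: iff_trans (iff_sym (hom_prod _ _ _ _ _)).
by split=> [h|[c /hom_point_tree -> //]]; exists a => //; apply/hom_point_tree.
Qed.

Lemma heq_ract x p : heq (pruned_repr (ract TS_mul p x)) (tprod (pruned_repr p) (orepr x)).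
Proof.
case: x => [q|] /=; first exact: TS_mulP.
apply: hom_heq => V R a b; apply: iff_trans (iff_sym (hom_prod _ _ _ _ _)).
by split=> [h|[c h /hom_point_tree <- //]]; exists b => //; apply/hom_point_tree.
Qed.

Lemma TS_plusP p : heq (pruned_repr (TS_plus p)) (tplus0 (pruned_repr p)).
Proof. exact: (svalP (cid (TS_plus_ex p))). Qed.

Lemma TS_starP p : heq (pruned_repr (TS_star p)) (tstar0 (pruned_repr p)).
Proof. exact: (svalP (cid (TS_star_ex p))). Qed.

Lemma heq_prod (X X' Y Y' : tree Sig) : heq X X' -> heq Y Y' -> heq (tprod X Y) (tprod X' Y').
Proof.
move=> hX hY; apply: hom_heq => V R a b.
apply: iff_trans (hom_prod _ _ _ _ _) _; apply: iff_trans (iff_sym (hom_prod _ _ _ _ _)).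
by split=> -[c /(heq_hom _ _ _ hX) h1 /(heq_hom _ _ _ hY) h2]; exists c.
Qed.

Lemma heq_refl (X : tree Sig) : heq X X.
Proof. by split; apply: hle_refl. Qed.

Lemma heq_of_eq p q (X Y : tree Sig) :
  heq (pruned_repr p) X -> heq (pruned_repr q) Y -> p = q -> heq X Y.
Proof. by move=> h1 h2 E; subst q; apply: heq_trans h2; apply: heq_sym. Qed.

Lemma eq_of_heq p q (X Y : tree Sig) :
  heq (pruned_repr p) X -> heq (pruned_repr q) Y -> heq X Y -> p = q.
Proof.
move=> h1 h2 h; apply: TS_eq; apply: heq_trans h1 _; apply: heq_trans h _; exact: heq_sym.
Qed.

Lemma TS_plus_Rstar p : Rstar TS_mul p (TS_plus p).
Proof.
have hl x : heq (pruned_repr (lact TS_mul x (TS_plus p)))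
    (tprod (orepr x) (tplus0 (pruned_repr p))).
  apply: heq_trans (heq_lact _ _) _.
  by apply: heq_prod; [apply: heq_refl|apply: TS_plusP].
move=> x y; split=> E.
  have [h1 h2] := heq_of_eq (heq_lact x p) (heq_lact y p) E.
  by apply: eq_of_heq (hl x) (hl y) _; split; apply: hle_prod_plus => //;
    try exact: orepr_tree; apply: pruned_repr_tree.
have abs z : lact TS_mul z p = TS_mul (lact TS_mul z (TS_plus p)) p.
  by case: z => [z|] /=; rewrite -?TS_mulA TS_plusK.
by rewrite abs E -abs.
Qed.

Lemma TS_star_Lstar p : Lstar TS_mul p (TS_star p).
Proof.
have hl x : heq (pruned_repr (ract TS_mul (TS_star p) x))
    (tprod (tstar0 (pruned_repr p)) (orepr x)).
  apply: heq_trans (heq_ract _ _) _.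
  by apply: heq_prod; [apply: TS_starP|apply: heq_refl].
move=> x y; split=> E.
  have [h1 h2] := heq_of_eq (heq_ract x p) (heq_ract y p) E.
  by apply: eq_of_heq (hl x) (hl y) _; split; apply: hle_star_prod => //;
    try exact: orepr_tree; apply: pruned_repr_tree.
have abs z : ract TS_mul p z = TS_mul p (ract TS_mul (TS_star p) z).
  by case: z => [z|] /=; rewrite ?TS_mulA TS_starK.
by rewrite abs E -abs.
Qed.

Lemma TS_adequate : adequate TS_mul TS_plus TS_star.
Proof.
split; first exact: TS_mulA.
split; first exact: TS_idemC.
split=> p; split; [exact: TS_plus_idem|exact: TS_plus_Rstar|exact: TS_star_idem|].
exact: TS_star_Lstar.
Qed.

End TreeAlgebra.

(** * Generation by base trees and extension of maps *)

Section Freeness.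
Context (Sig : Type).
Implicit Types (p q : TS Sig) (T U : term Sig).

Lemma represents_mul p q T U : represents (pruned_repr p) T -> represents (pruned_repr q) U ->
  represents (pruned_repr (TS_mul p q)) (TMul T U).
Proof.
move=> hT hU V R a b; apply: iff_trans (iff_sym (hom_TS_mul R p q a b)).
by split=> -[c /hT h1 /hU h2]; exists c.
Qed.

Lemma represents_plus p T :
  represents (pruned_repr p) T -> represents (pruned_repr (TS_plus p)) (TPlus T).
Proof.
move=> hT V R a b; apply: iff_trans (iff_sym (hom_TS_plus R p a b)).
by split=> -[E [c /hT h]]; split=> //; exists c.
Qed.

Lemma represents_star p T :
  represents (pruned_repr p) T -> represents (pruned_repr (TS_star p)) (TStar T).
Proof.
move=> hT V R a b; apply: iff_trans (iff_sym (hom_TS_star R p a b)).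
by split=> -[E [c /hT h]]; split=> //; exists c.
Qed.

Lemma represents_gen p (a : Sig) : sval p (base_tree a) -> represents (pruned_repr p) (TGen a).
Proof.
move=> /mem_heq hp V R u v; apply: iff_trans (iff_sym (heq_hom R u v hp)).
exact: iff_sym (hom_base_tree a R u v).
Qed.

(** An edgeless graph separates them: [TOne] relates its point to itself, but a tree with an edge
    has no morphism there. *)
Lemma represents_nontrivial p T : represents (pruned_repr p) T -> ~ term_equiv T TOne.
Proof.
move=> hT h; have /hT [f [hf _ _]] : thom T (fun _ _ _ => False) tt tt by exact/h.
by case: (pruned_repr_edge p) => e; apply: hf e.
Qed.

Lemma represents_ex p : exists T, represents (pruned_repr p) T.
Proof. exact/is_tree_term/pruned_repr_tree. Qed.

Lemma represents_inj p q T :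
  represents (pruned_repr p) T -> represents (pruned_repr q) T -> p = q.
Proof. by move=> hp hq; apply: TS_ext => V R a b; apply: iff_trans (iff_sym (hp V R a b)) _. Qed.

Lemma represents_equiv p T U :
  represents (pruned_repr p) T -> represents (pruned_repr p) U -> term_equiv T U.
Proof. by move=> hT hU V R a b; apply: iff_trans (hT V R a b) (iff_sym (hU V R a b)). Qed.

(** Induction runs over terms, of which those equivalent to [TOne] represent no element of [TS] and
    are set aside as a separate case. *)
Lemma TS_ind (P : TS Sig -> Prop) :
  (forall a p, sval p (base_tree a) -> P p) ->
  (forall p q, P p -> P q -> P (TS_mul p q)) ->
  (forall p, P p -> P (TS_plus p)) -> (forall p, P p -> P (TS_star p)) ->
  forall p, P p.
Proof.
move=> hgen hmul hplus hstar p0.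
have key T : term_equiv T TOne \/ exists2 p, represents (pruned_repr p) T & P p.
  elim: T => [|a|T [hT|[p hT pP]] U [hU|[q hU qP]]|T [hT|[p hT pP]]|T [hT|[p hT pP]]].
  - by left.
  - right; have [p hp] := TS_base a.
    by exists p; [apply: represents_gen|apply: hgen hp].
  - left=> V R a b; split; first by case=> c /hT /= -> /hU.
    by move=> E; exists a; [apply/hT|apply/hU].
  - right; exists q => // V R a b; apply: iff_trans (hU V R a b); split.
      by case=> c /hT /= ->.
    by exists a => //; apply/hT.
  - right; exists p => // V R a b; apply: iff_trans (hT V R a b); split.
      by case=> c + /hU /= <-.
    by exists b => //; apply/hU.
  - by right; exists (TS_mul p q); [apply: represents_mul|apply: hmul].
  - by left=> V R a b; split=> [[]|/= ->] //; split=> //; exists b; apply/hT.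
  - by right; exists (TS_plus p); [apply: represents_plus|apply: hplus].
  - by left=> V R a b; split=> [[]|/= ->] //; split=> //; exists b; apply/hT.
  - by right; exists (TS_star p); [apply: represents_star|apply: hstar].
have [T hT] := represents_ex p0.
have [/(represents_nontrivial hT)//|[p hp pP]] := key T.
by rewrite (represents_inj hT hp).
Qed.

Section Extension.
Context (S : Type) (mul : S -> S -> S) (plus star : S -> S).
Context (adS : adequate mul plus star) (chi : Sig -> S).

Let value T : option S := @term_val Sig (adjoin_monoid adS) (fun a => Some (chi a)) T.

(** In the adjoined monoid [None] arises only from [None], so such a term contains no generator. *)
Lemma term_val_None T : value T = None -> term_equiv T TOne.
Proof.
elim: T => [|a|T hT U hU|T hT|T hT] //=.
- rewrite /value /= -/(value T) -/(value U).
  case ET: (value T) => [x|]; case EU: (value U) => [y|] // _.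
  move=> V R a b; split; first by case=> c /(hT ET) /= -> /(hU EU).
  by move=> E; exists a; [apply/(hT ET)|apply/(hU EU)].
- rewrite /value /= -/(value T); case ET: (value T) => [x|] // _ V R a b.
  by split=> [[]|/= ->] //; split=> //; exists b; apply/(hT ET).
- rewrite /value /= -/(value T); case ET: (value T) => [x|] // _ V R a b.
  by split=> [[]|/= ->] //; split=> //; exists b; apply/(hT ET).
Qed.

(** A tree type is sent to the value of any term representing it: [term_equiv_val] removes the
    choice, and the tree has an edge, so the value is not [None]. *)
Lemma TS_extension : exists h : TS Sig -> S,
  morph211 (@TS_mul Sig) (@TS_plus Sig) (@TS_star Sig) mul plus star h /\
  (forall a p, sval p (base_tree a) -> h p = chi a).
Proof.
have /choice [h hh] : forall p, exists s, forall T,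
    represents (pruned_repr p) T -> value T = Some s.
  move=> p; have [T hT] := represents_ex p.
  case ET: (value T) => [s|]; last by case: (represents_nontrivial hT); apply: term_val_None.
  exists s => U hU; rewrite -ET.
  exact: (@term_equiv_val _ (adjoin_monoid adS) _ U T (represents_equiv hU hT)).
exists h; split; last first.
  by move=> a p ha; have := hh _ _ (represents_gen ha); rewrite /value /= => -[->].
split; [|split].
- move=> p q; have [T hT] := represents_ex p; have [U hU] := represents_ex q.
  have := hh _ _ (represents_mul hT hU).
  by rewrite /value /= -/(value T) -/(value U) (hh _ _ hT) (hh _ _ hU) => -[].
- move=> p; have [T hT] := represents_ex p.
  by have := hh _ _ (represents_plus hT); rewrite /value /= -/(value T) (hh _ _ hT) => -[].
- move=> p; have [T hT] := represents_ex p.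
  by have := hh _ _ (represents_star hT); rewrite /value /= -/(value T) (hh _ _ hT) => -[].
Qed.

End Extension.

End Freeness.

Theorem theorem5p16 (Sig : Type) :
  exists (tmul : TS Sig -> TS Sig -> TS Sig) (tplus tstar : TS Sig -> TS Sig),
    pruned_ops tmul tplus tstar /\
    (forall a : Sig, exists p : TS Sig, sval p (base_tree a)) /\
    adequate tmul tplus tstar /\
    (forall (S : Type) (mul : S -> S -> S) (plus star : S -> S),
       adequate mul plus star ->
       forall chi : Sig -> S,
         (exists h : TS Sig -> S,
            morph211 tmul tplus tstar mul plus star h /\
            (forall a p, sval p (base_tree a) -> h p = chi a)) /\
         (forall h1 h2 : TS Sig -> S,
            morph211 tmul tplus tstar mul plus star h1 ->
            (forall a p, sval p (base_tree a) -> h1 p = chi a) ->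
            morph211 tmul tplus tstar mul plus star h2 ->
            (forall a p, sval p (base_tree a) -> h2 p = chi a) ->
            forall p, h1 p = h2 p)).
Proof.
exists (@TS_mul Sig), (@TS_plus Sig), (@TS_star Sig).
split; first exact: TS_pruned_ops.
split; first exact: TS_base.
split; first exact: TS_adequate.
move=> S mul plus star adS chi; split; first exact: (TS_extension adS).
move=> h1 h2 [m1 [p1 s1]] b1 [m2 [p2 s2]] b2; apply: TS_ind.
- by move=> a p hp; rewrite (b1 a) // (b2 a).
- by move=> p q E1 E2; rewrite m1 m2 E1 E2.
- by move=> p E; rewrite p1 p2 E.
- by move=> p E; rewrite s1 s2 E.
Qed.
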